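(* Let $d>2$ and let $K:\mathbb{S}^{d-1}\times\mathbb{S}^{d-1}\to\mathbb{C}$ be a Hermitian, axially symmetric kernel of the form $$K(\xi,\zeta)=\sum_{\ell_1=-\infty}^{\infty}\ \sum_{\ell,\ell'\in\Lambda_{|\ell_1|}}c_{\ell_1}(\ell,\ell')\,Y_{\ell_1,\ell}(\xi)\,\overline{Y_{\ell_1,\ell'}(\zeta)},\qquad \xi,\zeta\in\mathbb{S}^{d-1},$$ with $$\sum_{\ell_1=-\infty}^{\infty}\ \sum_{\ell,\ell'\in\Lambda_{|\ell_1|}}|c_{\ell_1}(\ell,\ell')|\,\frac{\sqrt{N_{\ell_{d-1},d}N_{\ell'_{d-1},d}}}{\sigma_{d-1}}<\infty .$$ For each $\ell_1\in\mathbb{Z}$ let $\alpha\mapsto\ell^{(\alpha)}=(\ell_2^{(\alpha)},\ldots,\ell_{d-1}^{(\alpha)})$, $\alpha=1,2,\ldots$, be a bijective enumeration of $\Lambda_{|\ell_1|}$ with $\ell_{d-1}^{(\alpha')}\le\ell_{d-1}^{(\alpha)}$ whenever $\alpha'<\alpha$, put $N_\alpha=N_{\ell_{d-1}^{(\alpha)},d}$, and define the infinite matrix $$\tilde A^{\ell_1}=\left(\tilde a^{\ell_1}_{\alpha,\alpha'}\right)_{\alpha,\alpha'=1}^{\infty},\qquad \tilde a^{\ell_1}_{\alpha,\alpha'}=\sqrt{N_\alpha}\;c_{\ell_1}\!\left(\ell^{(\alpha)},\ell^{(\alpha')}\right)\sqrt{N_{\alpha'}} .$$ Suppose that for every $\ell_1\in\mathbb{Z}$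 the matrix $\tilde A^{\ell_1}$ is positive definite (that is, all its finite sections $(\tilde a^{\ell_1}_{\alpha,\alpha'})_{\alpha,\alpha'=1}^{n}$, $n\ge 1$, are positive definite matrices) and that there is $\sigma_{\ell_1}\in(0,1)$, independent of $\alpha$, such that $$\sum_{\alpha'\ne\alpha}\left|\tilde a^{\ell_1}_{\alpha,\alpha'}\right|<\sigma_{\ell_1}\left|\tilde a^{\ell_1}_{\alpha,\alpha}\right|\qquad\text{for all }\alpha\ge 1 .$$ Then $K$ is strictly positive definite on $\mathbb{S}^{d-1}$.
   Context: A Hermitian kernel $K:\Omega\times\Omega\to\mathbb{C}$ ($K(x,y)=\overline{K(y,x)}$) is called strictly positive definite on $\Omega$ if for every finite set $\Xi\subset\Omega$ of distinct points the matrix $(K(\xi,\zeta))_{\xi,\zeta\in\Xi}$ is positive definite on $\mathbb{C}^{|\Xi|}$. $\mathbb{S}^{d-1}$ is the unit sphere in $\mathbb{R}^d$ and $\sigma_{d-1}$ its surface area. $N_{0,d}=1$, $N_{j,d}=\frac{(2j+d-2)(j+d-3)!}{j!(d-2)!}$ for $j\ge1$. For $\ell_1\in\mathbb{Z}$, $\Lambda_{|\ell_1|}=\{\ell=(\ell_2,\ldots,\ell_{d-1})\in\mathbb{Z}^{d-2}:|\ell_1|\le\ell_2\le\cdots\le\ell_{d-1}\}$. In polar coordinates $\xi=(\theta_1,\ldots,\theta_{d-1})$, $\theta_1\in[0,2\pi)$, $\theta_j\in[0,\pi]$ for $j\ge2$ ($\xi_d=\cos\theta_{d-1}$, $\xi_{d-1}=\sin\theta_{d-1}\cos\theta_{d-2}$,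 ..., $\xi_2=\sin\theta_{d-1}\cdots\sin\theta_2\sin\theta_1$, $\xi_1=\sin\theta_{d-1}\cdots\sin\theta_2\cos\theta_1$), the functions $$Y_{\ell_1,\ell}(\xi)=Y_{\ell_1,\ldots,\ell_{d-1}}(\xi)=\frac{1}{\sqrt{2\pi}}e^{i\ell_1\theta_1}\prod_{j=2}^{d-1}{}_{j}\tilde P_{\ell_j}^{\ell_{j-1}}(\theta_j)$$ form an orthonormal basis of $L^2(\mathbb{S}^{d-1})$ of spherical harmonics ($Y_{\ell_1,\ell}$ has degree $\ell_{d-1}$), where ${}_{j}\tilde P_{L}^{\ell}(\theta)={}_{j}c_L^{\ell}(\sin\theta)^{(2-j)/2}P_{L+(j-2)/2}^{-(\ell+(j-2)/2)}(\cos\theta)$ (extended continuously to $\theta\in\{0,\pi\}$), $P_\nu^\mu$ are the associated Legendre functions on $(-1,1)$ and ${}_{j}c_L^{\ell}=\left(\frac{2L+j-1}{2}\frac{(L+\ell+j-2)!}{(L-\ell)!}\right)^{1/2}$. Axially symmetric means invariant under simultaneous rotation $\theta_1\mapsto\theta_1+\alpha$ of both arguments for every $\alpha$ (every kernel of the displayed form has this property). *)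

(* Defs.v *)
From HB Require Import structures.
From mathcomp Require Import all_boot all_order all_algebra.
From mathcomp Require Import all_classical all_reals all_analysis.
From mathcomp Require Import complex.

Set Implicit Arguments.
Unset Strict Implicit.
Unset Printing Implicit Defensive.

Import Order.TTheory GRing.Theory Num.Theory.
Import numFieldNormedType.Exports.

Local Open Scope classical_set_scope.
Local Open Scope ring_scope.
Local Open Scope complex_scope.

(* Positive definiteness of complex matrices.  In the order of [R[i]],
   [0 < z] means that [z] is real and positive, so positivity of the quadratic
   form already forces the matrix to be Hermitian. *)
Definition posdefmx (R : realType) (n : nat) (A : 'M[R[i]]_n) : Prop :=
  forall v : 'cV[R[i]]_n, v != 0 ->
    0 < \sum_(i < n) \sum_(j < n) (v i 0)^* * A i j * v j 0.

Definition hermitian_kernel (R : realType) (T : Type) (Omega : set T)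
    (K : T -> T -> R[i]) : Prop :=
  forall x y, Omega x -> Omega y -> K x y = (K y x)^*.

Definition strictly_posdef_kernel (R : realType) (T : Type) (Omega : set T)
    (K : T -> T -> R[i]) : Prop :=
  forall (n : nat) (x : 'I_n -> T), injective x -> (forall i, Omega (x i)) ->
    posdefmx (\matrix_(i < n, j < n) K (x i) (x j)).

(* Unordered convergence: the net of finite partial sums of [f] over [D]
   converges to [s].  For complex families this is the same as absolute
   convergence with sum [s]. *)
Definition has_sum (R : realType) (T : choiceType) (D : set T) (f : T -> R[i])
    (s : R[i]) : Prop :=
  forall eps : R, 0 < eps ->
    exists2 A, fsets D A & forall B, fsets D B -> A `<=` B ->
      Normc.normc (\sum_(x \in B) f x - s) < eps.

Section special_functions.
Variable R : realType.

(* Gauss' product for the entire function 1 / Gamma, which vanishes at the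
   nonpositive integers. *)
Definition rgamma (z : R) : R :=
  lim ((fun n : nat =>
    (\prod_(0 <= k < n.+1) (z + k%:R)) / (n`!%:R * n%:R `^ z)) @ \oo).

Definition pochhammer (a : R) (k : nat) : R := \prod_(0 <= i < k) (a + i%:R).

(* Gauss' hypergeometric series divided by Gamma(c) (Olver's bold F); this is
   defined also when c is a nonpositive integer. *)
Definition hyp2F1reg (a b c z : R) : R :=
  lim (series (fun k : nat =>
    pochhammer a k * pochhammer b k * rgamma (c + k%:R) / k`!%:R * z ^+ k)
    @ \oo).

(* The associated Legendre function of the first kind of degree [nu] and order
   [mu] on the cut (-1, 1) (Ferrers function). *)
Definition legendreP (nu mu x : R) : R :=
  ((1 + x) / (1 - x)) `^ (mu / 2)
  * hyp2F1reg (nu + 1) (- nu) (1 - mu) ((1 - x) / 2).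

(* Only used for [2 <= j] and [`|l| <= L], where the arguments of the
   factorials are nonnegative. *)
Definition legendre_const (j : nat) (L l : int) : R :=
  Num.sqrt ((2 * L%:~R + j%:R - 1) / 2
            * (`|(L + l + j%:Z - 2)%R|%N`!)%:R / (`|(L - l)%R|%N`!)%:R).

Definition legendre_tilde_open (j : nat) (L l : int) (t : R) : R :=
  legendre_const j L l * sin t `^ ((2 - j%:R) / 2)
  * legendreP (L%:~R + (j%:R - 2) / 2) (- (l%:~R + (j%:R - 2) / 2)) (cos t).

Definition legendre_tilde (j : nat) (L l : int) (t : R) : R :=
  if t <= 0 then lim (legendre_tilde_open j L l s @[s --> 0^'+])
  else if pi <= t then lim (legendre_tilde_open j L l s @[s --> pi^'-])
  else legendre_tilde_open j L l t.

End special_functions.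

Section sphere.
Variables (R : realType) (d : nat).

Definition unit_sphere : set 'rV[R]_d := [set x | \sum_(i < d) x 0 i ^+ 2 = 1].

(* 2 pi^(d/2) / Gamma(d/2) *)
Definition sphere_area : R := 2 * pi `^ (d%:R / 2) * rgamma (d%:R / 2).

Definition harmonic_dim (j : nat) : R :=
  if j == 0%N then 1
  else ((2 * j + d - 2) * (j + d - 3)`!)%:R / (j`! * (d - 2)`!)%:R.

(* Angles are numbered from 1: the tuple lists theta_1, ..., theta_{d-1}. *)
Definition theta (t : (d - 1).-tuple R) (j : nat) : R := nth 0 t j.-1.

Definition polar_range (t : (d - 1).-tuple R) : Prop :=
  0 <= theta t 1 < 2 * pi /\
  forall j, (2 <= j < d)%N -> 0 <= theta t j <= pi.

(* The entry of index [i] is the coordinate xi_{i+1}. *)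
Definition polar (t : (d - 1).-tuple R) : 'rV[R]_d :=
  \row_(i < d)
    if i == 0%N :> nat then cos (theta t 1) * \prod_(2 <= j < d) sin (theta t j)
    else if i == 1%N :> nat then
      sin (theta t 1) * \prod_(2 <= j < d) sin (theta t j)
    else cos (theta t i) * \prod_(i.+1 <= j < d) sin (theta t j).

Definition rotate_axis (a : R) (t : (d - 1).-tuple R) : (d - 1).-tuple R :=
  [tuple (if i == 0%N :> nat then tnth t i + a else tnth t i) | i < (d - 1)%N].

(* [polar] accepts arbitrary angles, so theta_1 + a need not be reduced
   modulo 2 pi. *)
Definition axially_symmetric (K : 'rV[R]_d -> 'rV[R]_d -> R[i]) : Prop :=
  forall (a : R) (t u : (d - 1).-tuple R), polar_range t -> polar_range u ->
    K (polar (rotate_axis a t)) (polar (rotate_axis a u))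
    = K (polar t) (polar u).

(* A tuple [l] lists l_2, ..., l_{d-1}. *)
Definition Lambda (l1 : int) : set ((d - 2).-tuple int) :=
  [set l | path <=%R `|l1| l].

Definition full_index (l1 : int) (l : (d - 2).-tuple int) (j : nat) : int :=
  nth 0 (l1 :: l) j.-1.

(* l_{d-1}, nonnegative on [Lambda l1] *)
Definition degree (l : (d - 2).-tuple int) : nat := `|(last 0 l)%R|%N.

(* The spherical harmonics in polar coordinates. *)
Definition Ysph (l1 : int) (l : (d - 2).-tuple int) (t : (d - 1).-tuple R)
    : R[i] :=
  ((Num.sqrt (2 * pi))^-1)%:C
  * (cos (l1%:~R * theta t 1) +i* sin (l1%:~R * theta t 1))
  * (\prod_(2 <= j < d)
       legendre_tilde j (full_index l1 l j) (full_index l1 l j.-1) (theta t j))%:C.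

(* Index set of the expansion: triples (l_1, l, l'). *)
Definition expansion_index
    : set (int * (d - 2).-tuple int * (d - 2).-tuple int) :=
  [set p | Lambda p.1.1 p.1.2 /\ Lambda p.1.1 p.2].

Definition tilde_a
    (c : int -> (d - 2).-tuple int -> (d - 2).-tuple int -> R[i]) (l1 : int)
    (e : nat -> (d - 2).-tuple int) (a b : nat) : R[i] :=
  (Num.sqrt (harmonic_dim (degree (e a))))%:C * c l1 (e a) (e b)
  * (Num.sqrt (harmonic_dim (degree (e b))))%:C.

End sphere.

(* Main.v *)
(** The quadratic form of [K] at points [x_i] with weights [v_i] is the unordered
sum of [c_{l1}(l,l') eta_{l1,l} conj(eta_{l1,l'})], where
[eta_{l1,l} = sum_i conj(v_i) Y_{l1,l}(x_i)].  Over a finite square section of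
the indices, diagonal dominance and [2|xy| <= |x|^2 + |y|^2] bound its real part
below by a positive combination of the [|eta|^2], uniformly in the section; so
the form is positive unless every [eta] vanishes.

If every [eta] vanishes, then [v = 0].  On [[0, pi]] the factor
[_j P~_{l+m}^l(t)] is a nonzero constant times [sin^l t * G_m(cos t)] with [G_m]
a polynomial of degree exactly [m].  The degree [l_{d-1}] being free, its last
factor can be interpolated to isolate the points with a given
[cos theta_{d-1}]; where [sin theta_{d-1}] is nonzero one divides by its power
and goes on with the remaining angles, and where it vanishes there is a single
point (a pole).

The closed form of [_j P~] comes from the three-term recurrence in the degree,
which holds for the hypergeometric series coefficient by coefficient, and from
the binomial series in degree [m = 0]. *)

Require Import Defs.
From HB Require Import structures.
From mathcomp Require Import all_boot all_order all_algebra.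
From mathcomp Require Import all_classical all_reals all_analysis.
From mathcomp Require Import complex ring lra zify.
Import Order.TTheory GRing.Theory Num.Theory.
Import numFieldNormedType.Exports.
Local Open Scope classical_set_scope.
Local Open Scope ring_scope.
Local Open Scope complex_scope.

Set Implicit Arguments.
Unset Strict Implicit.
Unset Printing Implicit Defensive.

(** * Gauss' product for 1 / Gamma at 1, 3/2, 2, 5/2, .. *)

Section rgamma_half_integers.
Variable R : realType.

Definition rgamma_seq (z : R) (n : nat) : R :=
  (\prod_(0 <= k < n.+1) (z + k%:R)) / (n`!%:R * n%:R `^ z).

(** Finite form of z / Gamma(z + 1) = 1 / Gamma(z): the last factor tends to 1. The index [n.+1]
    keeps the base of the power nonzero. *)
Lemma rgamma_seqS (z : R) (n : nat) :
  z * rgamma_seq (z + 1) n.+1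
  = rgamma_seq z n.+1 * ((z + 1) * n.+1%:R^-1 + 1).
Proof.
rewrite /rgamma_seq powRD; last by rewrite pnatr_eq0 implybT.
rewrite powRr1 ?ler0n// big_nat_recr//= [in RHS]big_nat_recl//= addr0.
rewrite (eq_bigr (fun k => z + k.+1%:R)); last first.
  by move=> k _; rewrite -addrA -[in RHS]natr1 [k%:R + 1]addrC.
have h1 : (n.+1)%:R != 0 :> R by rewrite pnatr_eq0.
have h2 : (n.+1)`!%:R != 0 :> R by rewrite pnatr_eq0 -lt0n fact_gt0.
have h3 : n.+1%:R `^ z != 0 :> R by rewrite powR_eq0 negb_and h1.
by field; rewrite nat1r h1 h2 h3.
Qed.

Lemma rgamma_seqS_cvg (z l : R) : z != 0 ->
  rgamma_seq z @ \oo --> l -> rgamma_seq (z + 1) @ \oo --> l / z.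
Proof.
move=> z0 cl; rewrite -(cvg_shiftS (rgamma_seq (z + 1))).
have -> : [sequence rgamma_seq (z + 1) n.+1]_n =
   (fun n => rgamma_seq z n.+1 * ((z + 1) * n.+1%:R^-1 + 1) / z).
  by apply/funext => n; rewrite -rgamma_seqS mulrAC mulfV// mul1r.
apply: cvgM; last exact: cvg_cst.
rewrite -[X in _ --> X]mulr1; apply: cvgM; first by rewrite (cvg_shiftS (rgamma_seq z)).
rewrite -[X in _ --> X](add0r (1 : R)); apply: cvgD; last exact: cvg_cst.
rewrite -[X in _ --> X](mulr0 (z + 1)); apply: cvgMr.
exact: cvg_harmonic.
Qed.

Lemma rgamma_seq1_cvg : rgamma_seq 1 @ \oo --> (1 : R).
Proof.
rewrite -(cvg_shiftS (rgamma_seq 1)).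
have -> : [sequence rgamma_seq 1 n.+1]_n = (fun n => n.+1%:R^-1 + 1 :> R).
  apply/funext => n /=; rewrite /rgamma_seq powRr1 ?ler0n//.
  have -> : \prod_(0 <= k < n.+2) (1 + k%:R : R) = n.+2`!%:R.
    elim: n.+2 => [|k IH]; first by rewrite big_nil.
    by rewrite big_nat_recr//= IH factS natrM mulrC nat1r.
  rewrite factS natrM -(natr1 n.+1).
  have h1 : (n.+1)%:R != 0 :> R by rewrite pnatr_eq0.
  have h2 : (n.+1)`!%:R != 0 :> R by rewrite pnatr_eq0 -lt0n fact_gt0.
  by field; rewrite nat1r h1 h2.
suff : (fun n => n.+1%:R^-1 + 1 : R) @ \oo --> (0 + 1 : R) by rewrite add0r.
by apply: cvgD; [exact: cvg_harmonic | exact: cvg_cst].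
Qed.

(** A Wallis-type estimate: by induction, the square of the product divided by the factorial grows
    at least linearly. It keeps the limit away from 0. *)
Lemma rgamma_seq_half_ge (n : nat) : 1/2 <= rgamma_seq (1/2 : R) n.+1.
Proof.
rewrite /rgamma_seq div1r powR12_sqrt ?ler0n//.
have f0 (k : nat) : 0 < k`!%:R :> R by rewrite ltr0n fact_gt0.
have key (m : nat) : m%:R + 1 <= 4 * ((\prod_(0 <= k < m.+1) (2^-1 + k%:R)) / m`!%:R) ^+ 2 :> R.
  elim: m => [|m IH]; first by rewrite big_nat1 fact0; lra.
  rewrite big_nat_recr//= factS natrM.
  set P := \prod_(_ <= _ < _) _ in IH *.
  have -> : P * (2^-1 + m.+1%:R) / (m.+1%:R * m`!%:R) =
            P / m`!%:R * ((2^-1 + m.+1%:R) / m.+1%:R).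
    by field; rewrite gt_eqF//= ?f0// nat1r pnatr_eq0.
  rewrite exprMn mulrA.
  apply: le_trans (ler_wpM2r (sqr_ge0 _) IH).
  rewrite expr_div_n mulrA ler_pdivlMr; last by rewrite exprn_gt0// ltr0n.
  have m0 : 0 <= m%:R :> R by rewrite ler0n.
  rewrite -(natr1 m); move: m%:R m0 => y y0. by nra.
set P := \prod_(_ <= _ < _) _.
have P0 : 0 <= P by apply: prodr_ge0 => k _; rewrite addr_ge0// invr_ge0.
have s0 : 0 < Num.sqrt (n.+1%:R : R) by rewrite sqrtr_gt0 ltr0n.
rewrite ler_pdivlMr ?mulr_gt0//.
rewrite -(@ler_pXn2r _ 2)//; last first.
  - by rewrite nnegrE !mulr_ge0// ltW.
rewrite !exprMn sqr_sqrtr ?ler0n//.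
have := key n.+1; rewrite -/P expr_div_n (mulrA 4) ler_pdivlMr ?exprn_gt0//.
move: (f0 n.+1); set F := _`!%:R; move=> F0.
have : 0 <= F ^+ 2 by exact: sqr_ge0.
nra.
Qed.

Lemma rgamma_seq_half_nonincreasing :
  nonincreasing_seq (fun n => rgamma_seq (1/2 : R) n.+1).
Proof.
apply/nonincreasing_seqP => n; rewrite /rgamma_seq div1r !powR12_sqrt ?ler0n//.
have f0 (k : nat) : 0 < k`!%:R :> R by rewrite ltr0n fact_gt0.
rewrite big_nat_recr//= (factS n.+1) natrM.
set P := \prod_(_ <= _ < _) _.
have P0 : 0 <= P by apply: prodr_ge0 => k _; rewrite addr_ge0// invr_ge0.
have s0 (m : nat) : 0 < Num.sqrt (m.+1%:R : R) by rewrite sqrtr_gt0 ltr0n.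
have -> : P * (2^-1 + n.+2%:R) / (n.+2%:R * (n.+1)`!%:R * Num.sqrt n.+2%:R) =
    P / ((n.+1)`!%:R * Num.sqrt n.+1%:R) *
    ((2^-1 + n.+2%:R) * Num.sqrt n.+1%:R / (n.+2%:R * Num.sqrt n.+2%:R)).
  by field; rewrite !gt_eqF//= ?f0// -?(natr1 n.+1) addr_gt0// ltr0n.
rewrite ler_piMr ?divr_ge0 ?mulr_ge0 ?ler0n ?sqrtr_ge0//.
rewrite ler_pdivrMr ?mulr_gt0 ?ltr0n// mul1r.
(* Squaring the ratio of consecutive terms leaves (n + 5/2)^2 (n + 1) <= (n + 2)^3. *)
rewrite -(@ler_pXn2r _ 2)// ?nnegrE ?mulr_ge0 ?ler0n ?addr_ge0 ?invr_ge0 ?sqrtr_ge0//.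
rewrite !exprMn !sqr_sqrtr ?ler0n// -(natr1 n.+1) -(natr1 n).
have m0 : 0 <= n%:R :> R by rewrite ler0n.
nra.
exact: (ler0n R n.+1).
Qed.

(** The base cases are 1, from factorials, and 3/2, from the decreasing sequence at 1/2, which is
    bounded below. The functional equation then adds 1 to the argument, that is 2 to n. *)
Lemma rgamma_seq_cvg_half (n : nat) :
  exists2 l : R, 0 < l & rgamma_seq (1 + n%:R / 2) @ \oo --> l.
Proof.
elim/ltn_ind: n => -[_|[_|n IH]].
- by exists 1; [exact: ltr01 | rewrite mul0r addr0; exact: rgamma_seq1_cvg].
- have cvg : cvgn (fun n => rgamma_seq (1/2 : R) n.+1).
    apply: (nonincreasing_is_cvgn rgamma_seq_half_nonincreasing).
    exists (1/2) => _ [n _ <-]; exact: rgamma_seq_half_ge.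
  exists (limn (fun n => rgamma_seq (1/2 : R) n.+1) / (1/2)).
    apply: divr_gt0; last by lra.
    apply: (@lt_le_trans _ _ (1/2)); first by lra.
    apply: limr_ge => //; apply: nearW => n; exact: rgamma_seq_half_ge.
  rewrite addrC; apply: rgamma_seqS_cvg; first by rewrite mul1r invr_eq0 pnatr_eq0.
  by move: cvg; rewrite /= (cvg_shiftS (rgamma_seq (1/2))).
have [l l0 cl] := IH n (leqW (leqnn _)).
have z0 : 0 < 1 + n%:R / 2 :> R by rewrite ltr_pwDl ?divr_ge0 ?ler0n.
exists (l / (1 + n%:R / 2)); first by rewrite divr_gt0.
have -> : 1 + n.+2%:R / 2 = 1 + n%:R / 2 + 1 :> R by rewrite -2!natr1; field.
by apply: rgamma_seqS_cvg => //; rewrite gt_eqF.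
Qed.

Lemma rgamma_gt0 (n : nat) : 0 < rgamma (1 + n%:R / 2 : R).
Proof.
have [l l0 /cvg_lim cl] := rgamma_seq_cvg_half n.
by rewrite /rgamma -[X in 0 < X]/(lim (rgamma_seq _ @ \oo)) cl.
Qed.

Lemma rgammaS (n : nat) :
  rgamma (1 + n%:R / 2 : R) = (1 + n%:R / 2) * rgamma (1 + n%:R / 2 + 1).
Proof.
have [l l0 cl] := rgamma_seq_cvg_half n.
have z0 : 1 + n%:R / 2 != 0 :> R.
  by rewrite gt_eqF// ltr_pwDl ?divr_ge0 ?ler0n.
have cl' := rgamma_seqS_cvg z0 cl.
rewrite /rgamma -[LHS]/(lim (rgamma_seq _ @ \oo)).
rewrite -[X in _ = _ * X]/(lim (rgamma_seq _ @ \oo)).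
by rewrite (cvg_lim _ cl)// (cvg_lim _ cl')// mulrC divfK.
Qed.

End rgamma_half_integers.

(** * The binomial series *)

Section binomial_series.
Variable R : realType.
Implicit Types (a t z : R) (n N k : nat).

Lemma pochhammer0 a : pochhammer a 0 = 1.
Proof. by rewrite /pochhammer big_nil. Qed.

Lemma pochhammerSr a k : pochhammer a k.+1 = pochhammer a k * (a + k%:R).
Proof. by rewrite /pochhammer big_nat_recr. Qed.

Lemma pochhammerSl a k : pochhammer a k.+1 = a * pochhammer (a + 1) k.
Proof.
rewrite /pochhammer big_nat_recl//= addr0; congr (_ * _).
by apply: eq_bigr => i _; rewrite -addrA nat1r.
Qed.

(** The terms of the expansion of (1 - t)^(-a). *)
Definition binomial_term a t k : R := pochhammer a k / k`!%:R * t ^+ k.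

(** The partial sum approximates (1 - t)^(-a), so the product is nearly constant: its derivative
    telescopes to a single term of order t^N. *)
Lemma is_derive_powR_binomial a N t : t < 1 ->
  is_derive t 1 (fun t => (1 - t) `^ a * series (binomial_term a t) N.+1)
    (- ((1 - t) `^ (a - 1) * (pochhammer a N.+1 / N`!%:R * t ^+ N))).
Proof.
move=> t1.
have dP : is_derive t 1 (fun t => (1 - t) `^ a) (- (a * (1 - t) `^ (a - 1))).
  have t1' : 0 < 1 - t by rewrite subr_gt0.
  have d1 : is_derive t 1 (fun u => 1 - u) (-1).
    by rewrite -[X in is_derive _ _ _ X]sub0r; exact: (is_deriveB (is_derive_cst _ _ _) (is_derive_id _ _)).
  have := @is_derive1_comp R (fun u => u `^ a) (fun u => 1 - u) t
    (a * (1 - t) `^ (a - 1)) (-1) (is_derive1_powR _ t1') d1.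
  by rewrite mulrN1.
elim: N => [|N IH].
  have -> : (fun t => (1 - t) `^ a * series (binomial_term a t) 1)
      = (fun t => (1 - t) `^ a).
    apply/funext => u; rewrite /series/= big_nat1 /binomial_term.
    by rewrite pochhammer0 expr0 divr1 !mulr1.
  by rewrite expr0 divr1 mulr1 pochhammerSr pochhammer0 mul1r addr0 mulrC.
have -> : (fun t => (1 - t) `^ a * series (binomial_term a t) N.+2) =
  (fun t => (1 - t) `^ a * series (binomial_term a t) N.+1) +
  (fun t => (1 - t) `^ a) * ((pochhammer a N.+1 / N.+1`!%:R) \*: (id ^+ N.+1)).
  apply/funext => u; rewrite /= !fctE.
  by rewrite /series/= big_nat_recr//= mulrDr.
set c := pochhammer a N.+1 / N.+1`!%:R.
have d2 : is_derive t 1 (c \*: (id ^+ N.+1)) (c *: ((N.+1%:R * t ^+ N) *: 1)).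
  by apply: is_derive_eq.
have := is_deriveD IH (is_deriveM dP d2).
suff -> : - ((1 - t) `^ (a - 1) * (pochhammer a N.+1 / N`!%:R * t ^+ N)) +
    ((1 - t) `^ a *: (c *: ((N.+1%:R * t ^+ N) *: 1)) +
     (c \*: id ^+ N.+1) t *: - (a * (1 - t) `^ (a - 1))) =
  - ((1 - t) `^ (a - 1) * (pochhammer a N.+2 / N.+1`!%:R * t ^+ N.+1)) by [].
have -> : (1 - t) `^ a = (1 - t) `^ (a - 1) * (1 - t).
  have x0 : 1 - t != 0 by rewrite subr_eq0 gt_eqF.
  rewrite -[X in _ = _ * X]powRr1 ?subr_ge0 ?ltW// -powRD ?subrK//.
  by rewrite x0 implybT.
have cE : c \*: id ^+ N.+1 = (fun u => c * u ^+ N.+1).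
  by apply/funext => u /=; rewrite exprfctE.
rewrite cE {cE d2} /c (pochhammerSr _ N.+1) factS natrM exprS -![_ *: _]/(_ * _).
have f0 : N`!%:R != 0 :> R by rewrite pnatr_eq0 -lt0n fact_gt0.
by field; rewrite f0 nat1r pnatr_eq0.
Qed.

(* From index [n] on, the ratio of consecutive coefficients is at most 1 in
   absolute value. *)
Lemma binomial_coef_bounded n : exists C : R, forall N,
  `|pochhammer (- (n%:R / 2)) N.+1 / N`!%:R| <= C.
Proof.
pose u N : R := `|pochhammer (- (n%:R / 2)) N.+1 / N`!%:R|.
(* This sum dominates each of the first n + 1 values, and the later values do not increase. *)
exists (\sum_(i < n.+1) u i) => N; rewrite -/(u N).
have [Nn|] := leqP N n.
  rewrite (bigD1 (Ordinal (Nn : (N < n.+1)%N)))//= lerDl sumr_ge0// => i _.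
  exact: normr_ge0.
elim: N => // N IH; rewrite ltnS => nN.
have {}IH : u N <= \sum_(i < n.+1) u i.
  move: nN; rewrite leq_eqVlt => /orP[/eqP <-|]; last exact: IH.
  rewrite big_ord_recr/= lerDr sumr_ge0// => i _; exact: normr_ge0.
apply: le_trans IH; rewrite /u pochhammerSr factS natrM.
have f0 : N`!%:R != 0 :> R by rewrite pnatr_eq0 -lt0n fact_gt0.
set P := pochhammer _ _.
have -> : P * (- (n%:R / 2) + N.+1%:R) / (N.+1%:R * N`!%:R) =
  P / N`!%:R * ((N.+1%:R - n%:R / 2) / N.+1%:R).
  by field; rewrite f0 nat1r pnatr_eq0.
rewrite normrM ler_piMr// normrM normfV (ger0_norm (ler0n _ _)).
rewrite ler_pdivrMr ?ltr0n// mul1r ler_norml.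
have : n%:R <= N%:R :> R by rewrite ler_nat.
have : 0 <= n%:R :> R by rewrite ler0n.
by rewrite -natr1 => *; apply/andP; split; lra.
Qed.

(** By the mean value theorem on [0, z], the product [g] of (1 - t)^a and a partial sum differs at z
    from its value 1 at 0 by at most a constant times z^N. Hence it tends to 1, and dividing by (1 -
    z)^a gives the limit. *)
Lemma binomial_series_cvg n z : 0 < z < 1 ->
  series (binomial_term (- (n%:R / 2)) z) @ \oo --> (1 - z) `^ (n%:R / 2).
Proof.
move=> /andP[z0 z1]; set a := - (n%:R / 2).
have [C hC] := binomial_coef_bounded n; rewrite -/a in hC.
have C0 : 0 <= C by apply: le_trans (hC 0%N).
have a0 : a <= 0 by rewrite oppr_le0 divr_ge0.
pose g N t := (1 - t) `^ a * series (binomial_term a t) N.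
have g0 N : g N.+1 0 = 1.
  rewrite /g subr0 powR1 mul1r /series/= big_nat_recl//= big1 ?addr0.
    by rewrite /binomial_term pochhammer0 expr0 divr1 mulr1.
  by move=> i _; rewrite /binomial_term expr0n mulr0.
have gz N : `|g N.+1 z - 1| <= (1 - z) `^ (a - 1) * (C * z ^+ N).
  have [c cz eq] : exists2 c, c \in `]0, z[ & g N.+1 z - g N.+1 0 =
     - ((1 - c) `^ (a - 1) * (pochhammer a N.+1 / N`!%:R * c ^+ N)) * (z - 0).
    apply: (@MVT R (g N.+1) _ 0 z z0) => [x|].
      rewrite in_itv/= => /andP[_ xz]; apply: is_derive_powR_binomial.
      exact: lt_trans xz z1.
    apply: derivable_within_continuous => x; rewrite in_itv/= => /andP[_ xz].
    apply: ex_derive; apply: is_derive_powR_binomial.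
    exact: le_lt_trans xz z1.
  rewrite -[X in `|_ - X|](g0 N) eq subr0 !(normrM, normrN) normrX.
  move: cz; rewrite in_itv/= => /andP[c0 cz].
  rewrite (ger0_norm (powR_ge0 _ _)) (gtr0_norm c0) (gtr0_norm z0) -mulrA.
  apply: ler_pM; rewrite ?powR_ge0 ?mulr_ge0 ?exprn_ge0 ?normr_ge0 ?(ltW c0) ?(ltW z0)//.
    (* The exponent a - 1 is negative, so (1 - c)^(a - 1) increases with c and is bounded by its
       value at z. *)
    have -> : a - 1 = - (1 - a) by rewrite opprB.
    rewrite !powRN lef_pV2 ?posrE ?powR_gt0 ?subr_gt0//; last exact: lt_trans z1.
    apply: ge0_ler_powR; rewrite ?nnegrE ?subr_ge0 ?(le_trans a0)//; try exact: ltW.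
      by rewrite ltW// (lt_trans cz).
    by rewrite lerD2l lerN2 ltW.
  rewrite -normrM -mulrA; apply: ler_pM; rewrite ?normr_ge0 ?mulr_ge0 ?exprn_ge0 ?(ltW c0) ?(ltW z0)//.
  apply: (@le_trans _ _ (c ^+ N)).
    by rewrite ler_piMr ?exprn_ge0 ?ltW.
  by apply: lerXn2r; rewrite ?nnegrE ltW.
have cg : (fun N => g N.+1 z) @ \oo --> (1 : R).
  apply/subr_cvg0/norm_cvg0P.
  apply: (@squeeze_cvgr _ _ _ _ (cst 0) (fun N => (1 - z) `^ (a - 1) * (C * z ^+ N))).
  - by apply: nearW => N; rewrite normr_ge0 gz.
  - exact: cvg_cst.
  rewrite -(mulr0 ((1 - z) `^ (a - 1))); apply: cvgMr.
  by apply: cvg_geometric; rewrite gtr0_norm.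
have p0 : (1 - z) `^ a != 0 by rewrite gt_eqF ?powR_gt0 ?subr_gt0.
have -> : n%:R / 2 = - a by rewrite opprK.
have -> : (1 - z) `^ (- a) = ((1 - z) `^ a)^-1 * 1 by rewrite mulr1 powRN.
rewrite -(cvg_shiftS (series _)).
have -> : [sequence series (binomial_term a z) k.+1]_k =
    (fun k => ((1 - z) `^ a)^-1 * g k.+1 z).
  by apply/funext => k; rewrite /g/= mulKf.
exact: cvgMr.
Qed.

End binomial_series.

(** * Ultraspherical polynomials as sums of hypergeometric series *)

Section ultraspherical_polynomials.
Variable R : realType.
Implicit Types (a t z A : R) (n N m k : nat).

(* The Gegenbauer polynomial of degree [m] and parameter [(n + 1) / 2],
   normalized to take the value 1 at 1. *)
Fixpoint ultraspherical n m : {poly R} :=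
  if m is m1.+1 then
    ((n + 2 * m1 + 1)%:R / (n + m1 + 1)%:R) *: ('X * ultraspherical n m1)
    - (m1%:R / (n + m1 + 1)%:R) *: (if m1 is m2.+1 then ultraspherical n m2 else 0)
  else 1.

(** The coefficient of the ['X] term in the recursion is nonzero and the other term has smaller
    degree. The exact degree is what interpolation relies on later. *)
Lemma size_ultraspherical n m : size (ultraspherical n m) = m.+1.
Proof.
elim/ltn_ind: m => -[_|m IH]; first by rewrite /= size_poly1.
have p0 : (n + 2 * m + 1)%:R / (n + m + 1)%:R != 0 :> R.
  by rewrite mulf_neq0 ?invr_neq0// pnatr_eq0 addn1.
have G0 : ultraspherical n m != 0 by rewrite -size_poly_gt0 IH.
rewrite [ultraspherical _ _.+1]/= size_polyDl.
  by rewrite size_scale// (mulrC 'X) size_mulX// IH.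
rewrite size_scale// (mulrC 'X) size_mulX// size_polyN IH// ltnS.
apply: (leq_trans (size_scale_leq _ _)).
case: m IH {p0 G0} => [|m] IH; first by rewrite size_poly0.
by rewrite IH.
Qed.

(** The terms of the series in [legendreP] for degree A and order -n/2. *)
Definition legendre_term n A z k : R :=
  pochhammer (A + 1) k * pochhammer (- A) k * rgamma (1 + n%:R / 2 + k%:R)
  / k`!%:R * z ^+ k.

Lemma rgamma_add n k :
  rgamma (1 + n%:R / 2 + k%:R : R)
  = (1 + n%:R / 2 + k%:R) * rgamma (1 + n%:R / 2 + k.+1%:R).
Proof.
have -> : 1 + n%:R / 2 + k%:R = 1 + (n + 2 * k)%:R / 2 :> R.
  by rewrite natrD natrM; field.
by rewrite rgammaS natrD natrM -natr1; congr (_ * rgamma _); field.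
Qed.

(** The recurrence (nu - mu + 1) P_(nu+1) = (2 nu + 1) x P_nu - (nu + mu) P_(nu-1) at nu = A, mu =
    -n/2, x = 1 - 2z, compared at the power k + 1 of z. *)
Lemma legendre_term_rec n A z k :
  (n%:R / 2 + A + 1) * legendre_term n (A + 1) z k.+1 =
  (2 * A + 1) * (legendre_term n A z k.+1 - 2 * z * legendre_term n A z k)
  - (A - n%:R / 2) * legendre_term n (A - 1) z k.+1.
Proof.
rewrite /legendre_term [in X in _ - 2 * z * X]rgamma_add.
(* A shift of the degree lengthens one Pochhammer symbol and shortens the other, so all terms become
   multiples of (A + 1)_k (-A)_k. *)
have -> : pochhammer (A + 1 + 1) k.+1 * pochhammer (- (A + 1)) k.+1 =
    - (pochhammer (A + 1) k.+2 * pochhammer (- A) k).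
  rewrite (pochhammerSl (- (A + 1))) (pochhammerSl (A + 1) k.+1).
  by rewrite (_ : - (A + 1) + 1 = - A); ring.
have -> : pochhammer (A - 1 + 1) k.+1 * pochhammer (- (A - 1)) k.+1 =
    - (pochhammer (A + 1) k * pochhammer (- A) k.+2).
  rewrite subrK (pochhammerSl (- A)) (pochhammerSl A).
  by rewrite (_ : - (A - 1) = - A + 1); ring.
rewrite !(pochhammerSr (A + 1)) !(pochhammerSr (- A)) factS natrM exprS.
have f0 : k`!%:R != 0 :> R by rewrite pnatr_eq0 -lt0n fact_gt0.
move: (rgamma _) (pochhammer (A + 1) k) (pochhammer (- A) k) => r P Q.
by field; rewrite f0 nat1r pnatr_eq0.
Qed.

Lemma series_legendre_term_rec n A z N :
  (n%:R / 2 + A + 1) * series (legendre_term n (A + 1) z) N.+1 =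
  (2 * A + 1) * (series (legendre_term n A z) N.+1
                 - 2 * z * series (legendre_term n A z) N)
  - (A - n%:R / 2) * series (legendre_term n (A - 1) z) N.+1.
Proof.
rewrite /series/=; elim: N => [|N IH].
  rewrite !big_nat1 big_nil /legendre_term /pochhammer !big_nil expr0 fact0 addr0.
  by field.
rewrite !(big_nat_recr N.+1)//= mulrDr IH legendre_term_rec.
by rewrite (big_nat_recr N)//=; ring.
Qed.

(** For A = n/2 the upper parameter A + 1 equals the lower parameter 1 + n/2; the two cancel and a
    binomial series remains. *)
Lemma legendre_term_half n z k :
  legendre_term n (n%:R / 2) z k
  = rgamma (1 + n%:R / 2) * binomial_term (- (n%:R / 2)) z k.
Proof.
have key : pochhammer (n%:R / 2 + 1 : R) k * rgamma (1 + n%:R / 2 + k%:R) =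
    rgamma (1 + n%:R / 2).
  elim: k => [|k IH]; first by rewrite pochhammer0 mul1r addr0.
  rewrite -IH pochhammerSr [in RHS]rgamma_add; ring.
by rewrite /legendre_term /binomial_term -key; ring.
Qed.

(** The recurrence for partial sums passes to the limit, where it is the recursion defining
    [ultraspherical]. *)
Lemma series_legendre_term_cvg n m z : 0 < z < 1 ->
  series (legendre_term n (n%:R / 2 + m%:R) z) @ \oo -->
  (1 - z) `^ (n%:R / 2) * rgamma (1 + n%:R / 2) *
    (ultraspherical n m).[1 - 2 * z].
Proof.
move=> z01; elim/ltn_ind: m => -[_|m IH].
  rewrite addr0 hornerC mulr1 [X in _ --> X]mulrC.
  have -> : series (legendre_term n (n%:R / 2) z) =
      (fun N => rgamma (1 + n%:R / 2) * series (binomial_term (- (n%:R / 2)) z) N).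
    apply/funext => N; rewrite /series/= big_distrr/=.
    by apply: eq_bigr => k _; exact: legendre_term_half.
  by apply: cvgMr; exact: binomial_series_cvg.
set A : R := n%:R / 2 + m%:R.
have -> : n%:R / 2 + m.+1%:R = A + 1 :> R by rewrite -(natr1 m) addrA.
set U := _ * rgamma _ in IH *.
have cA := IH m (leqnn _); rewrite -/A in cA.
have d0 : n%:R / 2 + A + 1 = (n + m + 1)%:R.
  by rewrite /A !natrD; field.
have d1 : 2 * A + 1 = (n + 2 * m + 1)%:R.
  by rewrite /A natrD (natrD _ n) natrM; field.
have d0' : (n + m + 1)%:R != 0 :> R by rewrite pnatr_eq0 addn1.
(* [l] is the limit for degree A - 1. For m = 0 that series has coefficient 0, and the value 0 is a
   placeholder. *)
pose l := if m is m'.+1 then U * (ultraspherical n m').[1 - 2 * z] else 0.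
have cB : (fun N => m%:R * series (legendre_term n (A - 1) z) N.+1) @ \oo --> m%:R * l.
  rewrite /l /A; case: (m) IH => [|m'] IH.
    have -> : (fun N => 0%:R * series (legendre_term n (n%:R / 2 + 0%:R - 1) z) N.+1) = cst 0.
      by apply/funext => N; rewrite mul0r.
    by rewrite mul0r; exact: cvg_cst.
  apply: cvgMr; rewrite (cvg_shiftS (series _)) -(natr1 m') addrA addrK.
  exact: IH.
rewrite -(cvg_shiftS (series _)).
have -> : [sequence series (legendre_term n (A + 1) z) N.+1]_N =
  (fun N => (n + m + 1)%:R^-1 * ((n + 2 * m + 1)%:R *
     (series (legendre_term n A z) N.+1 - 2 * z * series (legendre_term n A z) N)
     - m%:R * series (legendre_term n (A - 1) z) N.+1)).
  apply/funext => N; rewrite -d1.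
  have -> : m%:R = A - n%:R / 2 by rewrite /A addrAC subrr add0r.
  by rewrite -series_legendre_term_rec d0 mulKf.
have -> : U * (ultraspherical n m.+1).[1 - 2 * z] =
  (n + m + 1)%:R^-1 * ((n + 2 * m + 1)%:R *
    (U * (ultraspherical n m).[1 - 2 * z] - 2 * z * (U * (ultraspherical n m).[1 - 2 * z]))
    - m%:R * l).
  rewrite [ultraspherical _ _.+1]/= hornerD hornerN !hornerZ hornerM hornerX /l.
  by case: (m) => [|m']; rewrite ?horner0; ring.
apply: cvgMr; apply: cvgB => //; apply: cvgMr; apply: cvgB.
  by rewrite (cvg_shiftS (series _)).
exact: cvgMr.
Qed.

End ultraspherical_polynomials.

(** * Closed form of the normalized Legendre functions *)

Section legendre.
Variable R : realType.
Implicit Types (t : R) (j l m : nat).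

Lemma legendre_const_gt0 j l m : (2 <= j)%N ->
  0 < legendre_const R j (l + m)%:Z l%:Z.
Proof.
move=> j2; rewrite /legendre_const sqrtr_gt0.
apply: divr_gt0; last by rewrite ltr0n fact_gt0.
apply: mulr_gt0; last by rewrite ltr0n fact_gt0.
apply: divr_gt0 => //; rewrite -addrA; apply: ltr_wpDl.
  by rewrite mulr_ge0 ?ler0z.
by rewrite subr_gt0 ltr1n.
Qed.

(** With lam = l + (j - 2)/2, this is the normalization constant times 2^(-lam) / Gamma(1 + lam). *)
Definition legendre_scale j l m : R :=
  legendre_const R j (l + m)%:Z l%:Z
  * (2^-1 `^ ((2 * l + j - 2)%:R / 2) * rgamma (1 + (2 * l + j - 2)%:R / 2)).

Lemma legendre_scale_neq0 j l m : (2 <= j)%N -> legendre_scale j l m != 0.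
Proof.
move=> j2; rewrite gt_eqF// /legendre_scale.
by rewrite !mulr_gt0 ?legendre_const_gt0 ?powR_gt0 ?invr_gt0 ?rgamma_gt0.
Qed.

(** With x = cos t, the series contributes ((1 + x)/2)^lam and the prefactor ((1 + x)/(1 -
    x))^(-lam/2). Together they give (1 - x^2)^(lam/2) = (sin t)^lam up to the constant, and the
    factor (sin t)^((2 - j)/2) lowers the exponent from lam to l. *)
Lemma legendre_tilde_openE j l m t : (2 <= j)%N -> 0 < t < pi ->
  legendre_tilde_open j (l + m)%:Z l%:Z t =
  legendre_scale j l m * sin t ^+ l *
    (ultraspherical R (2 * l + j - 2) m).[cos t].
Proof.
move=> j2 tpi; have s0 : 0 < sin t by exact: sin_gt0_pi.
set n := (2 * l + j - 2)%N; set lam : R := n%:R / 2.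
have lamE : l%:R + (j%:R - 2) / 2 = lam.
  by rewrite /lam /n natrB ?natrD ?natrM; [field | lia].
have lmE : (l + m)%:Z%:~R + (j%:R - 2) / 2 = lam + m%:R.
  by rewrite -pmulrn natrD -lamE; ring.
rewrite /legendre_tilde_open /legendreP lmE -pmulrn lamE.
have cs := cos2Dsin2 t; set x := cos t in cs *.
have /andP[x1 x2] : -1 < x < 1.
  have x21 : x ^+ 2 < 1 by rewrite -cs ltrDl exprn_gt0.
  by apply/andP; split; nra.
have z01 : 0 < (1 - x) / 2 < 1 by apply/andP; split; lra.
have -> : hyp2F1reg (lam + m%:R + 1) (- (lam + m%:R)) (1 - - lam) ((1 - x) / 2)
    = (1 - (1 - x) / 2) `^ lam * rgamma (1 + lam) * (ultraspherical R n m).[x].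
  rewrite opprK; apply: cvg_lim => //.
  have := @series_legendre_term_cvg R n m _ z01; rewrite -/lam.
  by rewrite (_ : 1 - 2 * ((1 - x) / 2) = x)//; field.
have p0 : 0 < 1 + x by lra.
have q0 : 0 < 1 - x by lra.
have -> : 1 - (1 - x) / 2 = (1 + x) * 2^-1 by field.
rewrite powRM ?invr_ge0 ?(ltW p0)//.
rewrite powRM ?invr_ge0 ?(ltW p0) ?(ltW q0)// -(powR_inv1 (ltW q0)) -powRrM.
have -> : -1 * (- lam / 2) = lam / 2 by field.
have -> : - lam / 2 = - (lam / 2) by rewrite mulNr.
rewrite powRN.
have -> : (1 + x) `^ lam = (1 + x) `^ (lam / 2) * (1 + x) `^ (lam / 2).
  by rewrite -powRD ?(gt_eqF p0) ?implybT//; congr powR; field.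
have P0 : (1 + x) `^ (lam / 2) != 0 by rewrite gt_eqF ?powR_gt0.
have PQ : (1 + x) `^ (lam / 2) * (1 - x) `^ (lam / 2) * sin t `^ ((2 - j%:R) / 2) = sin t ^+ l.
  rewrite -powRM ?(ltW p0) ?(ltW q0)//.
  have -> : (1 + x) * (1 - x) = sin t ^+ 2.
    by rewrite (_ : sin t ^+ 2 = 1 - x ^+ 2); [ring | rewrite -cs; ring].
  rewrite -(powR_mulrn 2 (ltW s0)) -powRrM -powRD ?(gt_eqF s0) ?implybT//.
  rewrite -(powR_mulrn l (ltW s0)); congr powR.
  by rewrite -lamE; field.
  by rewrite -PQ /legendre_scale -/n -/lam; field.
exact: ltW.
Qed.

(** The closed form is continuous everywhere, so at 0 and pi it takes the one-sided limits by which
    [legendre_tilde] is defined there. *)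
Lemma legendre_tildeE j l m t : (2 <= j)%N -> 0 <= t <= pi ->
  legendre_tilde j (l + m)%:Z l%:Z t =
  legendre_scale j l m * sin t ^+ l *
    (ultraspherical R (2 * l + j - 2) m).[cos t].
Proof.
move=> j2 /andP[t0 tpi]; set h := fun s => legendre_scale j l m * sin s ^+ l *
    (ultraspherical R (2 * l + j - 2) m).[cos s].
have hcont : continuous h.
  move=> s; apply: cvgM; last first.
    apply: (@continuous_comp _ _ _ cos (horner _)); first exact: continuous_cos.
    exact: continuous_horner.
  apply: cvgMr; apply: (@continuous_comp _ _ _ sin (fun x => x ^+ l)).
    exact: continuous_sin.
  exact: exprn_continuous.
have openE s : 0 < s < pi -> h s = legendre_tilde_open j (l + m)%:Z l%:Z s.
  by move=> spi; rewrite legendre_tilde_openE.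
rewrite -/(h t) /legendre_tilde; case: ifPn => [t0'|]; last rewrite -ltNge => t0'.
  have -> : t = 0 by apply/eqP; rewrite eq_le t0 t0'.
  apply: cvg_lim => //; apply: (@cvg_trans _ (h s @[s --> 0^'+])).
    apply: near_eq_cvg; near=> s; apply: openE; apply/andP; split.
      by near: s; exact: nbhs_right_gt.
    by near: s; apply: nbhs_right_lt; exact: pi_gt0.
  by apply: cvg_at_right_filter; exact: hcont.
case: ifPn => [tpi'|]; last by rewrite -ltNge => ?; rewrite -openE ?t0'.
have -> : t = pi by apply/eqP; rewrite eq_le tpi tpi'.
apply: cvg_lim => //; apply: (@cvg_trans _ (h s @[s --> pi^'-])).
  apply: near_eq_cvg; near=> s; apply: openE; apply/andP; split.
    by near: s; apply: nbhs_left_gt; exact: pi_gt0.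
  by near: s; exact: nbhs_left_lt.
by apply: cvg_at_left_filter; exact: hcont.
Unshelve. all: by end_near. Qed.

End legendre.

(** * Separation of points by products of polynomials *)

Section separation.
Variables (F : fieldType) (n : nat).
Implicit Types (x w : 'I_n -> F).

(** Polynomials of each exact degree span all polynomials: a multiple of [p k] removes the top
    coefficient. *)
Lemma sum_horner_eq0 x w (p : nat -> {poly F}) :
  (forall m, size (p m) = m.+1) ->
  (forall m, \sum_i w i * (p m).[x i] = 0) ->
  forall q : {poly F}, \sum_i w i * q.[x i] = 0.
Proof.
move=> sp hp q; move: {2}(size q) (leqnn (size q)) => k.
elim: k q => [|k IH] q sq.
  move: sq; rewrite leqn0 size_poly_eq0 => /eqP ->.
  by rewrite big1// => i _; rewrite horner0 mulr0.
have pk0 : (p k)`_k != 0.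
  have -> : (p k)`_k = lead_coef (p k) by rewrite lead_coefE sp.
  by rewrite lead_coef_eq0 -size_poly_gt0 sp.
set a := q`_k / (p k)`_k.
have /IH : (size (q - a *: p k)%R <= k)%N.
  apply/leq_sizeP => i; rewrite leq_eqVlt coefB coefZ => /orP[/eqP <-|ki].
    by rewrite /a divfK// subrr.
  by rewrite !nth_default ?mulr0 ?subrr// ?sp// (leq_trans sq).
under eq_bigr do rewrite hornerD hornerN hornerZ mulrBr mulrCA.
by rewrite big_split/= sumrN -mulr_sumr hp mulr0 subr0.
Qed.

(** The test polynomial [q] vanishes at all nodes other than y, but not at y. *)
Lemma sum_level_eq0 x w (p : nat -> {poly F}) :
  (forall m, size (p m) = m.+1) ->
  (forall m, \sum_i w i * (p m).[x i] = 0) ->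
  forall y, \sum_(i | x i == y) w i = 0.
Proof.
move=> sp hp y; pose q := \prod_(i | x i != y) ('X - (x i)%:P).
have qy : q.[y] != 0.
  rewrite horner_prod; apply/prodf_neq0 => i xi.
  by rewrite hornerXsubC subr_eq0 eq_sym.
have := sum_horner_eq0 sp hp q; rewrite (bigID (fun i => x i == y))/=.
rewrite [X in _ + X]big1 ?addr0 => [|i xi]; last first.
  by rewrite /q horner_prod (bigD1 i)//= hornerXsubC subrr mul0r mulr0.
under eq_bigr => i /eqP xi do rewrite xi.
by rewrite -mulr_suml => /eqP; rewrite mulf_eq0 (negbTE qy) orbF => /eqP.
Qed.

Variables (E : 'I_n -> F) (c s : nat -> 'I_n -> F).
Variable G : nat -> nat -> nat -> {poly F}.
Hypothesis size_G : forall j l m, size (G j l m) = m.+1.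
Hypothesis G0 : forall j l, G j l 0%N = 1.

(* Equality of points in polar coordinates: where [s k] vanishes the lower
   angles are irrelevant. *)
Fixpoint same_polar k (i i0 : 'I_n) : bool :=
  if k is k'.+1 then
    (c k' i == c k' i0) && ((s k' i == 0) || same_polar k' i i0)
  else E i == E i0.

(** A spherical harmonic up to its constant: [E] stands for exp(i theta_1), [c j] and [s j] for the
    cosine and sine of theta_(j+2), [l 0] for l_1 and [l j.+1] for l_(j+2). *)
Definition polar_monomial (l : nat -> nat) k i : F :=
  E i ^+ l 0%N *
  \prod_(0 <= j < k) (s j i ^+ l j * (G j (l j) (l j.+1 - l j)).[c j i]).

Lemma polar_monomialS l k i : polar_monomial l k.+1 i =
  polar_monomial l k i * s k i ^+ l k * (G k (l k) (l k.+1 - l k)).[c k i].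
Proof. by rewrite /polar_monomial big_nat_recr//= !mulrA. Qed.

(** Induction on the number of angles above theta_1: the top index is free, so interpolation
    isolates one level of the last cosine, and the weights restricted to that level satisfy the
    hypothesis for one angle fewer. *)
Lemma polar_monomials_separate k w :
  (forall j i i', (j < k)%N -> c j i = c j i' -> s j i = s j i') ->
  (forall l : nat -> nat, {homo l : a b / (a <= b)%N} ->
     \sum_i w i * polar_monomial l k i = 0) ->
  forall i0, \sum_(i | same_polar k i i0) w i = 0.
Proof.
elim: k w => [|k IH] w hcs hw i0 /=; last have cs := hcs k _ _ (ltnSn k).
  apply: (@sum_level_eq0 E w (fun m => 'X^m)) => m; first by rewrite size_polyXn.
  rewrite -[RHS](hw (fun=> m)) ?leqnn//; apply: eq_bigr => i _.
  by rewrite /polar_monomial big_nil mulr1 hornerXn.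
have key (l : nat -> nat) : {homo l : a b / (a <= b)%N} ->
    \sum_(i | c k i == c k i0) w i * polar_monomial l k i * s k i ^+ l k = 0.
  move=> hl; apply: (@sum_level_eq0 (c k) _ (G k (l k))) => m; first exact: size_G.
  (* Above k the indices become l k + m. Monotonicity survives, the lower factors are unchanged, and
     the last polynomial has degree exactly m. *)
  pose l' j := if (j <= k)%N then l j else (l k + m)%N.
  have hl' : {homo l' : a b / (a <= b)%N}.
    move=> a b ab; rewrite /l'; case: (leqP b k) => bk.
      by rewrite (leq_trans ab bk) hl.
    case: ifP => // ak; exact: leq_trans (hl _ _ ak) (leq_addr _ _).
  rewrite -[RHS](hw l' hl'); apply: eq_bigr => i _.
  have lk : l' k = l k by rewrite /l' leqnn.
  have lk1 : l' k.+1 = (l k + m)%N by rewrite /l' ltnn.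
  rewrite polar_monomialS lk lk1 addKn !mulrA.
  congr (_ * _ * _); rewrite /polar_monomial.
  have -> : l' 0%N = l 0%N by [].
  congr (_ * _ * _).
  apply: eq_big_nat => j /andP[_ jk].
  by rewrite /l' (ltnW jk) jk.
(* At a pole the whole level is one class, and the zero indices make every monomial equal to 1. *)
case: (eqVneq (s k i0) 0) => [s0|s0].
  rewrite -[RHS](key (fun=> 0%N))//; apply: eq_big => [i|i _].
    by case: eqP => //= ci; rewrite (cs _ _ ci) s0 eqxx.
  rewrite /polar_monomial !expr0 mulr1 big1 ?mulr1// => j _.
  by rewrite expr0 G0 hornerC mulr1.
(* Off the pole, s k is a nonzero constant on the level, so its power can be cancelled. *)
pose w' i := if c k i == c k i0 then w i else 0.
rewrite -[RHS](IH w' _ _ i0); last first.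
  move=> l hl; apply: (mulIf (expf_neq0 (l k) s0)).
  rewrite mul0r -[RHS](key l hl) [RHS]big_mkcond/= mulr_suml; apply: eq_bigr => i _.
  by rewrite /w'; case: eqP => [/cs ->//|_]; rewrite !mul0r.
  by move=> j i i' jk; apply: hcs; exact: ltnW.
rewrite big_mkcond [RHS]big_mkcond; apply: eq_bigr => i _.
rewrite /w'; case: eqP => [/cs ->|_] /=; last by rewrite if_same.
by rewrite (negbTE s0).
Qed.

End separation.

(** * Polar coordinates on the sphere *)

Section polar_coordinates.
Variable R : realType.
Implicit Types (th : nat -> R) (k i : nat) (r : R).

(** The coordinates of [polar] for an angle sequence on nat, so that the dimension k can vary in
    inductions. *)
Definition polar_coord th k i : R :=
  if i == 0%N then cos (th 1%N) * \prod_(2 <= j < k) sin (th j)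
  else if i == 1%N then sin (th 1%N) * \prod_(2 <= j < k) sin (th j)
  else cos (th i) * \prod_(i.+1 <= j < k) sin (th j).

Lemma eq_polar_coord th th' k i : (2 <= k)%N -> (i < k)%N ->
  (forall j, (1 <= j < k)%N -> th j = th' j) ->
  polar_coord th k i = polar_coord th' k i.
Proof.
move=> k2 ik h.
have hp m : (1 <= m)%N ->
    \prod_(m <= j < k) sin (th j) = \prod_(m <= j < k) sin (th' j).
  move=> m1; apply: eq_big_nat => j /andP[mj jk].
  by rewrite h// jk (leq_trans m1 mj).
rewrite /polar_coord !hp// (h 1%N)//; case: eqVneq => // i0.
by case: eqVneq => // _; rewrite h// ik lt0n i0.
Qed.

Lemma polar_coordS th k i : (2 <= k)%N -> (i < k)%N ->
  polar_coord th k.+1 i = polar_coord th k i * sin (th k).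
Proof.
move=> k2 ik; rewrite /polar_coord !(big_nat_recr k)//= !mulrA.
by case: ifP => // _; case: ifP.
Qed.

Lemma polar_coord_last th k : (2 <= k)%N -> polar_coord th k.+1 k = cos (th k).
Proof.
by case: k => [|[|k]]// _; rewrite /polar_coord/= big_geq// mulr1.
Qed.

Lemma exists_polar2 (x y r : R) : 0 <= r -> x ^+ 2 + y ^+ 2 = r ^+ 2 ->
  exists2 a, 0 <= a < 2 * pi & x = r * cos a /\ y = r * sin a.
Proof.
move=> r0 xyr.
have [r0'|r0'] := eqVneq r 0.
  have p0 : 0 <= (0 : R) < 2 * pi by rewrite lexx mulr_gt0 ?pi_gt0.
  exists 0 => //; rewrite r0' !mul0r; split; apply/eqP; rewrite -sqrf_eq0.
    by rewrite eq_le sqr_ge0 andbT; have := sqr_ge0 y; move: xyr; rewrite r0'; nra.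
  by rewrite eq_le sqr_ge0 andbT; have := sqr_ge0 x; move: xyr; rewrite r0'; nra.
have rp : 0 < r by rewrite lt_neqAle eq_sym r0' r0.
set u := x / r; set v := y / r.
have xE : x = r * u by rewrite /u mulrC divfK.
have yE : y = r * v by rewrite /v mulrC divfK.
have uv : u ^+ 2 + v ^+ 2 = 1.
  by rewrite !expr_div_n -mulrDl xyr divff// expf_neq0.
have u1 : -1 <= u <= 1.
  by have v2 := sqr_ge0 v; apply/andP; split; nra.
have cu : cos (acos u) = u by rewrite acosK// in_itv.
have su : sin (acos u) = `|v|.
  by rewrite sin_acos// -uv addrAC subrr add0r sqrtr_sqr.
have a0 := acos_ge0 u1; have api := acos_lepi u1.
have pi0 := pi_gt0 R.
have [v0|v0] := leP 0 v.
  exists (acos u); first by rewrite a0/=; lra.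
  by rewrite cu su ger0_norm.
have u1' : u < 1 by nra.
have a0' : 0 < acos u by rewrite acos_gt0// u1'; case/andP: u1 => ->.
(* On the lower half circle the arccosine is reflected. It is positive there, which keeps the angle
   strictly below 2 pi. *)
exists (2 * pi - acos u); first by apply/andP; split; lra.
have -> : 2 * pi - acos u = - acos u + pi *+ 2 by rewrite mulr_natl addrC.
by rewrite cosD2pi sinD2pi cosN sinN cu su ltr0_norm// opprK.
Qed.

Lemma exists_polar k (x : nat -> R) r : 0 <= r ->
  \sum_(0 <= i < k.+2) x i ^+ 2 = r ^+ 2 ->
  exists th, [/\ 0 <= th 1%N < 2 * pi,
    forall j, (2 <= j < k.+2)%N -> 0 <= th j <= pi &
    forall i, (i < k.+2)%N -> x i = r * polar_coord th k.+2 i].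
Proof.
elim: k r => [|k IH] r r0.
  rewrite !big_nat_recr//= big_nil add0r => /(exists_polar2 r0)[a ha [hx hy]].
  exists (fun=> a); split => // [j|].
    by case/andP => /leq_ltn_trans h /h; rewrite ltnn.
  by move=> [|[|i]]// _; rewrite /polar_coord/= big_nil mulr1.
rewrite big_nat_recr//=; set S := \sum_(_ <= _ < _) _ => hS.
have S0 : 0 <= S by apply: sumr_ge0 => i _; exact: sqr_ge0.
have [a api xa] : exists2 a, 0 <= a <= pi & x k.+2 = r * cos a.
  have [r0'|r0'] := eqVneq r 0.
    exists 0; first by rewrite lexx pi_ge0.
    rewrite r0' mul0r; apply/eqP; rewrite -sqrf_eq0 eq_le sqr_ge0 andbT.
    by move: hS; rewrite r0'; nra.
  have rp : 0 < r by rewrite lt_neqAle eq_sym r0' r0.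
  have u1 : -1 <= x k.+2 / r <= 1.
    rewrite ler_pdivlMr// ler_pdivrMr// mulN1r mul1r.
    by apply/andP; split; nra.
  exists (acos (x k.+2 / r)); first by rewrite acos_ge0// acos_lepi.
  by rewrite acosK ?in_itv//= mulrC divfK.
have sa := sin_ge0_pi api.
have [] := IH (r * sin a); first exact: mulr_ge0.
  rewrite -/S exprMn sin2cos2 mulrBr mulr1 -exprMn -xa -hS; ring.
move=> th [th1 th2 hx].
exists (fun j => if j == k.+2 then a else th j); split => //.
  move=> j /andP[j2]; rewrite ltnS leq_eqVlt; case: eqVneq => // _ /= jk.
  by apply: th2; rewrite j2.
move=> i; rewrite ltnS leq_eqVlt => /orP[/eqP ->|ik].
  by rewrite polar_coord_last// eqxx xa.
rewrite polar_coordS// eqxx (hx i ik) -mulrA; congr (_ * _).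
rewrite mulrC; congr (_ * _); apply: eq_polar_coord => // j /andP[_ jk].
by rewrite lt_eqF.
Qed.

Lemma polarE d (t : (d - 1).-tuple R) (i : 'I_d) :
  polar t 0 i = polar_coord (theta t) d i.
Proof. by rewrite mxE. Qed.

Lemma polar_surjective d (x : 'rV[R]_d) : (2 < d)%N -> unit_sphere x ->
  exists2 t : (d - 1).-tuple R, polar_range t & polar t = x.
Proof.
case: d x => [|[|k]]// x k0 hx.
pose xn i : R := if insub i is Some i' then x 0 i' else 0.
have [] := @exists_polar k xn 1 ler01.
  rewrite expr1n -hx big_mkord; apply: eq_bigr => i _.
  by rewrite /xn valK.
move=> th [th1 th2 hth].
pose t : (k.+2 - 1).-tuple R := [tuple th i.+1 | i < (k.+2 - 1)%N].
have tE j : (1 <= j < k.+2)%N -> theta t j = th j.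
  case: j => // j /= jk; have jk' : (j < k.+2 - 1)%N by rewrite subn1.
  by have := tnth_mktuple (fun i : 'I_(k.+2 - 1) => th i.+1) (Ordinal jk'); rewrite (tnth_nth 0).
exists t.
  split; first by rewrite tE.
  move=> j /andP[j2 jk]; rewrite tE ?th2 ?j2 ?jk ?(ltnW j2)//.
apply/rowP => i; rewrite polarE.
rewrite (@eq_polar_coord _ th)//; first by rewrite -[LHS]mul1r -hth// /xn valK.
Qed.

Definition same_polar_of n (th : 'I_n -> nat -> R) :=
  same_polar (fun i : 'I_n => cos (th i 1%N) +i* sin (th i 1%N) : R[i])
    (fun j (i : 'I_n) => (cos (th i j.+2))%:C) (fun j (i : 'I_n) => (sin (th i j.+2))%:C).

Lemma sin_eq_of_cos (a b : R) : 0 <= a <= pi -> 0 <= b <= pi ->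
  cos a = cos b -> sin a = sin b.
Proof. by move=> ha hb /cos_inj -> //; rewrite in_itv. Qed.

Lemma same_polar_coord n (th : 'I_n -> nat -> R) k (i i0 : 'I_n) :
  (forall (i : 'I_n) j, (2 <= j < k.+2)%N -> 0 <= th i j <= pi) ->
  same_polar_of th k i i0 -> forall a, (a < k.+2)%N ->
  polar_coord (th i) k.+2 a = polar_coord (th i0) k.+2 a.
Proof.
elim: k => [|k IH] hth.
  rewrite /same_polar_of/= => /eqP[hc hs] [|[|a]]// _.
    by rewrite /polar_coord/= hc !big_geq.
  by rewrite /polar_coord/= hs !big_geq.
move=> /= /andP[/eqP[hc] hs] a; rewrite ltnS leq_eqVlt => /orP[/eqP ->|ak].
  by rewrite !polar_coord_last.
have hs' : sin (th i k.+2) = sin (th i0 k.+2).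
  by apply: sin_eq_of_cos => //; apply: hth; rewrite ltnS leqnn.
rewrite [LHS]polar_coordS// [RHS]polar_coordS// -hs'.
case/orP: hs => [/eqP[->]|hs]; first by rewrite !mulr0.
congr (_ * _); apply: IH => // i' j /andP[j2 jk].
by apply: hth; rewrite j2 ltnW.
Qed.

End polar_coordinates.

(** * Linear independence of point evaluations on spherical harmonics *)

Section harmonics.
Variables (R : realType) (d : nat).
Hypothesis hd : (2 < d)%N.

Lemma de_moivre (a : R) n :
  (cos a +i* sin a) ^+ n = cos (n%:R * a) +i* sin (n%:R * a) :> R[i].
Proof.
elim: n => [|n IH]; first by rewrite expr0 mul0r cos0 sin0.
rewrite exprSr IH -natr1 mulrDl mul1r cosD sinD; simpc.
by congr (_ +i* _); rewrite addrC.
Qed.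

Lemma path_homo_tuple (l : nat -> nat) : {homo l : a b / (a <= b)%N} ->
  Lambda (l 0%N)%:Z [tuple (l i.+1)%:Z | i < (d - 2)%N].
Proof.
move=> hl; rewrite /Lambda/=.
have -> : [seq (l (i : 'I_(d - 2)).+1)%:Z | i <- enum 'I_(d - 2)] =
    [seq (l j.+1)%:Z | j <- iota 0 (d - 2)].
  by rewrite -val_enum_ord -map_comp.
move: (d - 2)%N => k; elim: k 0%N => //= k IH a.
rewrite ger0_norm// lez_nat hl//=; have := IH a.+1.
by rewrite ger0_norm.
Qed.

Definition harmonic_poly j l m : {poly R[i]} :=
  map_poly (real_complex R) (ultraspherical R (2 * l + j.+2 - 2) m).

(** The constant collects 1 / sqrt(2 pi) and the scales of all Legendre factors; it depends on the
    indices but not on the point. A monotone [l] encodes the indices with l_1 >= 0. *)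
Lemma Ysph_polar_monomial n (t : 'I_n -> (d - 1).-tuple R) (l : nat -> nat) :
  (forall i, polar_range (t i)) -> {homo l : a b / (a <= b)%N} ->
  exists2 C : R[i], C != 0 & forall i,
   Ysph (l 0%N)%:Z [tuple (l i.+1)%:Z | i < (d - 2)%N] (t i) =
   C * polar_monomial
     (fun i => cos (theta (t i) 1%N) +i* sin (theta (t i) 1%N) : R[i])
     (fun j i => (cos (theta (t i) j.+2))%:C)
     (fun j i => (sin (theta (t i) j.+2))%:C) harmonic_poly l (d - 2) i.
Proof.
move=> ht hl.
pose a j := legendre_scale R j.+2 (l j) (l j.+1 - l j).
exists (((Num.sqrt (2 * pi))^-1 * \prod_(0 <= j < (d - 2)%N) a j)%:C).
  rewrite (fmorph_eq0 (real_complex R)) mulf_neq0//.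
    by rewrite invr_neq0// gt_eqF// sqrtr_gt0 mulr_gt0 ?pi_gt0.
  by rewrite prodf_seq_neq0; apply/allP => j _ /=; rewrite legendre_scale_neq0.
move=> i; rewrite /Ysph /polar_monomial de_moivre.
rewrite -pmulrn [in RHS]rmorphM/= -!mulrA; congr (_ * _).
rewrite [RHS]mulrCA; congr (_ * _).
set L := [tuple _ | _ < _].
have LE j : (j < d - 2)%N -> full_index (l 0%N) L j.+2 = (l j.+1)%:Z.
  move=> jd; have := tnth_mktuple (fun i : 'I_(d - 2) => (l i.+1)%:Z) (Ordinal jd).
  by rewrite (tnth_nth 0).
have -> : \prod_(2 <= j < d) legendre_tilde j (full_index (l 0%N) L j)
      (full_index (l 0%N) L j.-1) (theta (t i) j) =
    \prod_(0 <= j < d - 2) (a j * (sin (theta (t i) j.+2) ^+ l j *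
       (ultraspherical R (2 * l j + j.+2 - 2) (l j.+1 - l j)).[cos (theta (t i) j.+2)])).
  rewrite -[X in \prod_(X <= _ < _) _]add0n big_addn.
  apply: eq_big_nat => j /andP[_ jd]; rewrite addn2 LE//.
  have -> : full_index (l 0%N) L j.+2.-1 = (l j)%:Z.
    by case: j jd => // j jd; rewrite LE// ltnW.
  rewrite -{1}(subnKC (hl _ _ (leqnSn j))) legendre_tildeE//.
    by rewrite -mulrA.
  by apply: (ht i).2; lia.
rewrite big_split/= rmorphM; congr (_ * _).
rewrite rmorph_prod; apply: eq_bigr => j _.
by rewrite rmorphM rmorphXn /harmonic_poly horner_map.
Qed.

Lemma harmonics_separate n (t : 'I_n -> (d - 1).-tuple R) (w : 'I_n -> R[i]) :
  (forall i, polar_range (t i)) -> injective (fun i => polar (t i)) ->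
  (forall l1 l, Lambda l1 l -> \sum_i w i * Ysph l1 l (t i) = 0) ->
  forall i, w i = 0.
Proof.
move=> ht tinj hw i0.
have d2 : (d - 2).+2 = d by rewrite -addn2 subnK// ltnW.
have range_t i j : (2 <= j < (d - 2).+2)%N -> 0 <= theta (t i) j <= pi.
  by rewrite d2; exact: (ht i).2.
(* Since the points are distinct, each polar class is a singleton and its sum is a single weight. *)
have same_eq i : same_polar_of (fun i => theta (t i)) (d - 2) i i0 = (i == i0).
  apply/idP/eqP => [h|->]; last first.
    rewrite /same_polar_of; elim: (d - 2)%N => [|k IH] /=; first exact: eqxx.
    by rewrite eqxx IH orbT.
  apply: tinj; apply/rowP => a; rewrite !polarE.
  have := same_polar_coord range_t h; rewrite d2; exact.
have <- : \sum_(i | same_polar_of (fun i => theta (t i)) (d - 2) i i0) w i = w i0.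
  by rewrite (eq_bigl _ _ same_eq) big_pred1_eq.
apply: (@polar_monomials_separate _ n _ _ _ harmonic_poly).
- by move=> j l m; rewrite size_map_poly size_ultraspherical.
- by move=> j l; rewrite /harmonic_poly/= rmorph1.
- move=> j i i' jd [hc]; congr (_%:C); apply: sin_eq_of_cos hc.
    by apply: range_t; rewrite !ltnS.
  by apply: range_t; rewrite !ltnS.
move=> l hl; have [C C0 hC] := Ysph_polar_monomial ht hl.
apply: (mulfI C0); rewrite mulr0 mulr_sumr -[RHS](hw _ _ (path_homo_tuple hl)).
by apply: eq_bigr => i _; rewrite hC mulrCA.
Qed.

End harmonics.

(** * Unordered sums *)

Section unordered_sums.
Variables (R : realType) (T : choiceType) (D : set T).
Implicit Types (f g : T -> R[i]) (s t : R[i]).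

Lemma has_sum0 : has_sum D (fun=> 0) (0 : R[i]).
Proof.
move=> eps e0; exists set0; first exact: fsets_set0.
by move=> B _ _; rewrite fsbig1// subr0 Normc.normc0.
Qed.

Lemma has_sumD f g s t : has_sum D f s -> has_sum D g t ->
  has_sum D (fun x => f x + g x) (s + t).
Proof.
move=> hf hg eps e0; have e2 : 0 < eps / 2 by rewrite divr_gt0.
have [A [finA AD] hA] := hf _ e2; have [B [finB BD] hB] := hg _ e2.
exists (A `|` B); first by split; [rewrite finite_setU | rewrite subUset].
move=> C [finC CD]; rewrite subUset => -[AC BC].
rewrite fsbig_split// opprD addrACA [eps]splitr.
apply: le_lt_trans (le_normcD _ _) _.
by apply: ltrD; [apply: hA | apply: hB].
Qed.

Lemma has_sumZ f s (a : R[i]) : has_sum D f s ->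
  has_sum D (fun x => a * f x) (a * s).
Proof.
move=> hf; have [->|a0] := eqVneq a 0.
  rewrite mul0r; under [X in has_sum _ X]eq_fun do rewrite mul0r.
  exact: has_sum0.
move=> eps e0.
have na0 : 0 < Normc.normc a by rewrite -ltcR -normr_gt0 in a0 *.
have [A [finA AD] hA] := hf _ (divr_gt0 e0 na0).
exists A => // C fC AC; rewrite -mulr_fsumr -mulrBr Normc.normcM.
by rewrite mulrC -ltr_pdivlMr// hA.
Qed.

Lemma has_sum_sum (I : Type) (r : seq I) (f : I -> T -> R[i]) (s : I -> R[i]) :
  (forall i, has_sum D (f i) (s i)) ->
  has_sum D (fun x => \sum_(i <- r) f i x) (\sum_(i <- r) s i).
Proof.
move=> h; elim: r => [|i r IH].
  rewrite big_nil; under [X in has_sum _ X]eq_fun do rewrite big_nil.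
  exact: has_sum0.
rewrite big_cons; under [X in has_sum _ X]eq_fun do rewrite big_cons.
exact: has_sumD.
Qed.

(** Within tolerance delta of s there is a partial sum S with Re S >= delta; the strict inequality
    |S - s| < delta leaves Re s > 0. *)
Lemma has_sum_Re_gt0 f s (delta : R) (A0 : set T) : 0 < delta -> fsets D A0 ->
  has_sum D f s ->
  (forall A, fsets D A -> A0 `<=` A -> exists B, [/\ fsets D B, A `<=` B &
     delta <= complex.Re (\sum_(x \in B) f x)]) ->
  0 < complex.Re s.
Proof.
move=> d0 [finA0 A0D] hs hB; have [A [finA AD] hA] := hs _ d0.
have [|B [fB AB dB]] := hB (A `|` A0) _ (@subsetUr _ _ _).
  by split; [rewrite finite_setU | rewrite subUset].
have {hA} := hA B fB (subset_trans (@subsetUl _ _ _) AB).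
set S := \sum_(x \in B) f x in dB *; rewrite -ltcR => h.
have := le_lt_trans (normc_ge_Re (S - s)) h; rewrite ltcR raddfB/= ltr_norml.
by move=> /andP[_]; lra.
Qed.

End unordered_sums.

(** * Positive definite matrices and diagonally dominant forms *)

Section positive_forms.
Variable R : realType.

Lemma sum_mul_pred1 (K : pzSemiRingType) n (F : 'I_n -> K) i :
  \sum_j F j * (j == i)%:R = F i.
Proof.
rewrite (bigD1 i)//= eqxx mulr1 big1 ?addr0// => j /negbTE ->.
by rewrite mulr0.
Qed.

(** The form at the vector a e_i + b e_j. *)
Lemma posdefmx_pair n (A : 'M[R[i]]_n) i j (a b : R[i]) : posdefmx A ->
  i != j -> (a != 0) || (b != 0) ->
  0 < a^* * A i i * a + a^* * A i j * b + (b^* * A j i * a + b^* * A j j * b).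
Proof.
move=> hA ij ab0.
pose v : 'cV[R[i]]_n := \col_k (a * (k == i)%:R + b * (k == j)%:R).
have v0 : v != 0.
  apply: contraTneq ab0 => /colP v0; rewrite negb_or !negbK; apply/andP; split.
    by have := v0 i; rewrite !mxE eqxx (negbTE ij) mulr1 mulr0 addr0 => ->.
  have := v0 j; rewrite !mxE eqxx [j == i]eq_sym (negbTE ij) mulr1 mulr0 add0r.
  by move=> ->.
have := hA v v0; congr (0 < _).
have vE k : v k 0 = a * (k == i)%:R + b * (k == j)%:R by rewrite mxE.
have inner k : \sum_(l < n) (v k 0)^* * A k l * v l 0 =
    (v k 0)^* * (A k i * a + A k j * b).
  under eq_bigr => l _ do rewrite (vE l) mulrDr !mulrA.
  rewrite big_split/= !sum_mul_pred1; ring.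
under eq_bigr => k _ do rewrite inner vE rmorphD !rmorphM !rmorph_nat mulrDl
  mulrAC [X in _ + X]mulrAC.
rewrite big_split/= !sum_mul_pred1; ring.
Qed.

Lemma posdefmx_diag n (A : 'M[R[i]]_n) i : posdefmx A -> 0 < A i i.
Proof.
move=> hA; pose v : 'cV[R[i]]_n := \col_k (k == i)%:R.
have v0 : v != 0.
  apply/negP => /eqP/colP/(_ i); rewrite !mxE eqxx => /eqP.
  by rewrite oner_eq0.
have := hA v v0; congr (0 < _).
have vE k : v k 0 = (k == i)%:R by rewrite mxE.
under eq_bigr => k _ do under eq_bigr => l _ do rewrite (vE l).
under eq_bigr => k _ do rewrite sum_mul_pred1 vE rmorph_nat mulrC.
by rewrite sum_mul_pred1.
Qed.

(** The form is real at e_i + e_j and at e_i + i e_j; the vanishing imaginary parts relate the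
    imaginary, respectively real, parts of the two entries. *)
Lemma posdefmx_sym n (A : 'M[R[i]]_n) i j : posdefmx A -> A j i = (A i j)^*.
Proof.
move=> hA; have hd k := posdefmx_diag k hA.
case: (eqVneq i j) => [->|ij].
  have := hd j; case: (A j j) => x y; rewrite ltcE/= => /andP[/eqP -> _].
  by congr (_ +i* _); rewrite oppr0.
have n10 : (1 : R[i]) != 0 by exact: oner_neq0.
have := @posdefmx_pair n A i j 1 1 hA ij; rewrite n10 => /(_ isT).
have := @posdefmx_pair n A i j 1 'i hA ij; rewrite n10 => /(_ isT).
have := hd i; have := hd j.
move: (A i i) (A i j) (A j i) (A j j) => [p1 p2] [q1 q2] [r1 r2] [s1 s2].
rewrite !ltcE/=; simpc => /andP[/eqP -> _] /andP[/eqP -> _].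
move=> /andP[/eqP h1 _] /andP[/eqP h2 _].
by congr (_ +i* _); lra.
Qed.

Lemma normc_conj (z : R[i]) : Normc.normc z^* = Normc.normc z.
Proof. by case: z => x y /=; rewrite sqrrN. Qed.

Lemma normc_sqr (z : R[i]) : z * z^* = (Normc.normc z ^+ 2)%:C.
Proof. by rewrite -sqr_normc rmorphXn. Qed.

Lemma normc_ge0 (z : R[i]) : 0 <= Normc.normc z.
Proof. by case: z => x y; exact: sqrtr_ge0. Qed.

Lemma Re_ge_normc (z : R[i]) : - Normc.normc z <= complex.Re z.
Proof.
by have := normc_ge_Re z; rewrite lecR ler_norml => /andP[].
Qed.

(** Each off-diagonal term is at least -|A_ab| (|z_a|^2 + |z_b|^2) / 2, and dominance bounds the
    total loss by sg times the diagonal sum. *)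
Lemma Re_dominated_form n (A : nat -> nat -> R[i]) (d : nat -> R) (sg : R)
    (z : nat -> R[i]) :
  (forall a b, A b a = (A a b)^*) -> (forall a, A a a = (d a)%:C) ->
  (forall a, \sum_(b < n | b != a :> nat) Normc.normc (A a b) <= sg * d a) ->
  (1 - sg) * \sum_(a < n) d a * Normc.normc (z a) ^+ 2
  <= complex.Re (\sum_(a < n) \sum_(b < n) A a b * z a * (z b)^*).
Proof.
move=> hsym hdiag hdom; pose y a := Normc.normc (z a) ^+ 2.
pose off (a : 'I_n) := \sum_(b < n | b != a) Normc.normc (A a b) * (y a + y b) / 2.
have row (a : 'I_n) : d a * y a - off a
    <= complex.Re (\sum_(b < n) A a b * z a * (z b)^*).
  rewrite (bigD1 a)//= hdiag -mulrA normc_sqr -rmorphM raddfD/= lerD2l.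
  rewrite /off -sumrN raddf_sum; apply: ler_sum => b _.
  apply: le_trans (Re_ge_normc _); rewrite lerN2 !Normc.normcM normc_conj -!mulrA.
  apply: ler_wpM2l; first exact: normc_ge0.
  rewrite ler_pdivlMr// /y.
  have := sqr_ge0 (Normc.normc (z a) - Normc.normc (z b)); nra.
rewrite raddf_sum; apply: le_trans (ler_sum _ (fun a _ => row a)).
rewrite sumrB mulrBl mul1r lerD2l lerN2.
(* Exchanging a and b in the second half, with |A_ba| = |A_ab|, turns column sums into row sums. *)
have -> : \sum_a off a = \sum_(a < n) \sum_(b < n | b != a) Normc.normc (A a b) * y a.
  have -> : \sum_a off a =
      (\sum_(a < n) \sum_(b < n | b != a) Normc.normc (A a b) * y a +
       \sum_(a < n) \sum_(b < n | b != a) Normc.normc (A a b) * y b) / 2.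
    rewrite -big_split/= mulr_suml; apply: eq_bigr => a _.
    rewrite -big_split/= mulr_suml; apply: eq_bigr => b _.
    by rewrite mulrDr.
  rewrite [X in _ + X](exchange_big_dep predT)//=.
  rewrite [X in _ + X](eq_bigr
    (fun a : 'I_n => \sum_(b < n | b != a) Normc.normc (A a b) * y a)).
    by field.
  move=> a _; apply: eq_big => [b|b _]; first by rewrite eq_sym.
  by rewrite (hsym a b) normc_conj.
rewrite mulr_sumr; apply: ler_sum => a _; rewrite -mulr_suml [X in _ <= X]mulrA.
by apply: ler_wpM2r; [exact: sqr_ge0 | exact: hdom].
Qed.

End positive_forms.

(** * Finite square sections of the expansion *)

Section sections.
Variables (R : realType) (d : nat).
Hypothesis hd : (2 < d)%N.
Variable c : int -> (d - 2).-tuple int -> (d - 2).-tuple int -> R[i].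
Variable e : int -> nat -> (d - 2).-tuple int.

Lemma harmonic_dim_gt0 j : 0 < harmonic_dim R d j.
Proof.
rewrite /harmonic_dim; case: ifP => // j0.
by rewrite divr_gt0 ?ltr0n ?muln_gt0 ?fact_gt0 ?andbT//; lia.
Qed.

(** Substituting y_a / sqrt(N_a) into the form of [tilde_a] gives the form of [c]. The weights [k]
    do not depend on the size n of the section. *)
Lemma section_lower_bound l1 :
  (forall n, (1 <= n)%N ->
     posdefmx (\matrix_(a < n, b < n) tilde_a c l1 (e l1) a b)) ->
  (exists s : R, 0 < s < 1 /\ forall a : nat,
     (\esum_(b in [set b | b != a])
        (Normc.normc (tilde_a c l1 (e l1) a b))%:E
      < (s * Normc.normc (tilde_a c l1 (e l1) a a))%:E)%E) ->
  exists2 k : nat -> R, (forall a, 0 < k a) & forall n (y : nat -> R[i]),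
    \sum_(a < n) k a * Normc.normc (y a) ^+ 2 <=
    complex.Re (\sum_(a < n) \sum_(b < n)
      c l1 (e l1 a) (e l1 b) * y a * (y b)^*).
Proof.
have iotaE n : iota 0 n = index_iota 0 n by rewrite /index_iota subn0.
move=> hpos [sg [/andP[_ sg1] hdom]].
pose A a b := tilde_a c l1 (e l1) a b.
have hsym a b : A b a = (A a b)^*.
  have m0 : (0 < (maxn a b).+1)%N by [].
  have am : (a < (maxn a b).+1)%N by rewrite ltnS leq_maxl.
  have bm : (b < (maxn a b).+1)%N by rewrite ltnS leq_maxr.
  by have := posdefmx_sym (Ordinal am) (Ordinal bm) (hpos _ m0); rewrite !mxE.
have hdiag0 a : 0 < A a a.
  have := posdefmx_diag (@ord_max a) (hpos a.+1 isT); rewrite mxE; exact.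
pose D a := complex.Re (A a a).
have hdiag a : A a a = (D a)%:C.
  by rewrite /D; have := hdiag0 a; case: (A a a) => p q; rewrite ltcE/= => /andP[/eqP -> _].
have D0 a : 0 < D a by rewrite -ltcR -hdiag.
pose N a : R := Num.sqrt (harmonic_dim R d (degree (e l1 a))).
have N0 a : 0 < N a by rewrite sqrtr_gt0 harmonic_dim_gt0.
have hrow n a : \sum_(b < n | b != a :> nat) Normc.normc (A a b) <= sg * D a.
  have := hdom a; rewrite -/(A a a) hdiag.
  have -> : Normc.normc (D a)%:C = D a.
    by rewrite /= expr0n/= addr0 sqrtr_sqr gtr0_norm.
  move=> h; rewrite -lee_fin; apply: le_trans (ltW h); apply: esum_ge.
  exists [set` [seq b <- iota 0 n | b != a]].
    split; first exact: finite_seq.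
    by move=> b /=; rewrite mem_filter => /andP[].
  rewrite -fsbig_seq ?filter_uniq ?iota_uniq// sumEFin lee_fin big_filter.
  by rewrite iotaE big_mkord.
exists (fun a => (1 - sg) * D a / N a ^+ 2).
  by move=> a; rewrite divr_gt0 ?exprn_gt0// mulr_gt0// subr_gt0.
move=> n y; pose z a := y a * (N a)^-1%:C.
have := @Re_dominated_form R n A D sg z hsym hdiag (hrow n).
have -> : \sum_(a < n) \sum_(b < n) A a b * z a * (z b)^* =
    \sum_(a < n) \sum_(b < n) c l1 (e l1 a) (e l1 b) * y a * (y b)^*.
  apply: eq_bigr => a _; apply: eq_bigr => b _.
  have Nc k : (N k)%:C * (N k)^-1%:C = 1 :> R[i].
    by rewrite -rmorphM/= mulfV ?gt_eqF.
  (* Outside [%R], [^*] would be [conjc] instead of the [Num.conj] of the sums. *)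
  have zc k : ((z k)^* = (y k)^* * (N k)^-1%:C)%R.
    by rewrite /z rmorphM; congr (_ * _); exact: conjc_real.
  rewrite /A /tilde_a -/(N a) -/(N b) zc /z.
  rewrite -[RHS]mul1r -(Nc a) -[RHS]mul1r -(Nc b); ring.
congr (_ <= _); rewrite mulr_sumr; apply: eq_bigr => a _.
rewrite /z Normc.normcM.
have -> : Normc.normc ((N a)^-1)%:C = (N a)^-1.
  by rewrite /= expr0n/= addr0 sqrtr_sqr gtr0_norm ?invr_gt0.
by rewrite exprMn exprVn; ring.
Qed.

Hypothesis e_bij : forall l1, set_bij [set: nat] (@Lambda d l1) (e l1).

Lemma e_inj l1 : injective (e l1).
Proof.
by have [_ /in2TT h _] := e_bij l1; move=> a b /h; apply; rewrite inE.
Qed.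

(** Both l and l' run over the first n indices of the enumeration, so a sum over a section splits
    into one quadratic form for each l_1 in s. *)
Definition section_indices (s : seq int) n :=
  [seq (la.1, e la.1 la.2, e la.1 b) |
     la <- [seq (l, a) | l <- s, a <- iota 0 n], b <- iota 0 n].

Lemma section_indices_uniq s n : uniq s -> uniq (section_indices s n).
Proof.
move=> us; apply: allpairs_uniq; rewrite ?iota_uniq//.
  by apply: allpairs_uniq; rewrite ?iota_uniq// => -[? ?] [? ?].
move=> [[l a] b] [[l' a'] b'] _ _ /= [<-] /e_inj <- /e_inj <- //.
Qed.

Lemma mem_section_indices s n l a b : l \in s -> (a < n)%N -> (b < n)%N ->
  (l, e l a, e l b) \in section_indices s n.
Proof.
move=> ls an bn; apply/allpairsP; exists ((l, a), b); split=> //=.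
  by apply/allpairsP; exists (l, a); rewrite mem_iota.
by rewrite mem_iota.
Qed.

Lemma section_indices_sub s n :
  [set` section_indices s n] `<=` expansion_index (d := d).
Proof.
move=> p /= /allpairsP[[[l a] b] [_ _ ->]]; rewrite /expansion_index/=.
by have [h _ _] := e_bij l; split; apply: h.
Qed.

Lemma sum_section_indices s n (F : int * (d - 2).-tuple int * (d - 2).-tuple int -> R[i]) :
  \sum_(p <- section_indices s n) F p =
  \sum_(l <- s) \sum_(a < n) \sum_(b < n) F (l, e l a, e l b).
Proof.
have iotaE k : iota 0 k = index_iota 0 k by rewrite /index_iota subn0.
rewrite big_allpairs_dep big_allpairs_dep; apply: eq_bigr => l _ /=.
rewrite iotaE big_mkord; apply: eq_bigr => a _.
by rewrite big_mkord.
Qed.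

(** Cofinality of square sections: s collects the l_1 that occur, and n exceeds all positions in the
    enumerations. *)
Lemma finite_sub_section (A : set (int * (d - 2).-tuple int * (d - 2).-tuple int)) :
  fsets (expansion_index (d := d)) A ->
  exists s n, uniq s /\ A `<=` [set` section_indices s n].
Proof.
move=> [/finite_seqP[r ->] rD].
have /choice[g hg] : forall p, exists ab : nat * nat,
   p \in r -> p = (p.1.1, e p.1.1 ab.1, e p.1.1 ab.2).
  move=> p; have [pr|pr] := boolP (p \in r); last by exists (0, 0)%N.
  have [h1 h2] := rD p pr; have [_ _ hs] := e_bij p.1.1.
  have [a _ ha] := hs _ h1; have [b _ hb] := hs _ h2.
  by exists (a, b) => _ /=; rewrite ha hb -!surjective_pairing.
exists (undup [seq p.1.1 | p <- r]), (\max_(p <- r) maxn (g p).1 (g p).2).+1.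
split; first exact: undup_uniq.
move=> p /= pr; rewrite {1}(hg p pr).
have gp : (maxn (g p).1 (g p).2 <= \max_(p <- r) maxn (g p).1 (g p).2)%N.
  exact: (@leq_bigmax_seq _ r xpredT (fun p => maxn (g p).1 (g p).2) p pr isT).
apply: mem_section_indices.
- by rewrite mem_undup; apply: (map_f (fun p => p.1.1) pr).
- by rewrite ltnS (leq_trans (leq_maxl _ _) gp).
- by rewrite ltnS (leq_trans (leq_maxr _ _) gp).
Qed.

(** All blocks have nonnegative real part, and the block of an l_1 with a nonzero eta stays above a
    fixed positive bound. *)
Lemma expansion_Re_gt0 (eta : int -> (d - 2).-tuple int -> R[i]) (Q : R[i]) :
  (forall l1 n, (1 <= n)%N ->
     posdefmx (\matrix_(a < n, b < n) tilde_a c l1 (e l1) a b)) ->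
  (forall l1, exists s : R, 0 < s < 1 /\ forall a : nat,
     (\esum_(b in [set b | b != a])
        (Normc.normc (tilde_a c l1 (e l1) a b))%:E
      < (s * Normc.normc (tilde_a c l1 (e l1) a a))%:E)%E) ->
  (exists l1 l, Lambda l1 l /\ eta l1 l != 0) ->
  has_sum (expansion_index (d := d))
    (fun p => c p.1.1 p.1.2 p.2 * eta p.1.1 p.1.2 * (eta p.1.1 p.2)^*) Q ->
  0 < complex.Re Q.
Proof.
move=> hpos hdom [l0 [l [hl eta0]]] hQ.
have [_ _ /(_ l hl)[a0 _ ea0]] := e_bij l0; rewrite -ea0 in eta0.
have [k k0 hk] := section_lower_bound (hpos l0) (hdom l0).
have sec0 l1 n : 0 <= complex.Re (\sum_(a < n) \sum_(b < n)
    c l1 (e l1 a) (e l1 b) * eta l1 (e l1 a) * (eta l1 (e l1 b))^*).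
  have [k' k0' hk'] := section_lower_bound (hpos l1) (hdom l1).
  apply: le_trans (hk' n (fun a => eta l1 (e l1 a))).
  by apply: sumr_ge0 => a _; rewrite mulr_ge0 ?sqr_ge0 ?ltW.
(* A section containing p0 has l0 among its blocks and a0 below its size, so the a0 term of the
   lower bound alone contributes delta. *)
pose p0 := (l0, e l0 a0, e l0 a0).
pose delta := k a0 * Normc.normc (eta l0 (e l0 a0)) ^+ 2.
apply: (has_sum_Re_gt0 (delta := delta) (A0 := [set p0]) _ _ hQ).
- rewrite mulr_gt0// exprn_gt0// lt_neqAle normc_ge0 andbT eq_sym.
  by apply: contra_neq eta0 => /Normc.eq0_normc.
- split; first exact: finite_set1.
  by move=> _ ->; rewrite /expansion_index /p0/= ea0.
move=> A hA; rewrite sub1set inE => Ap0.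
have [s [n [us As]]] := finite_sub_section hA.
exists [set` section_indices s n]; split => //.
  by split; [exact: finite_seq | exact: section_indices_sub].
rewrite -fsbig_seq ?section_indices_uniq// sum_section_indices.
have [l0s a0n] : l0 \in s /\ (a0 < n)%N.
  have /allpairsP[[[l' a'] b'] [/= /allpairsP[[l'' a''] [/=]]]] := As _ Ap0.
  rewrite mem_iota => ls an [-> ->] _ [-> /e_inj -> _]; by split.
rewrite raddf_sum (bigD1_seq l0)//= -[X in X <= _]addr0 lerD//; last first.
  by apply: sumr_ge0 => l1 _; exact: sec0.
apply: le_trans (hk n (fun a => eta l0 (e l0 a))).
rewrite (bigD1 (Ordinal a0n))//= lerDl; apply: sumr_ge0 => a _.
by rewrite mulr_ge0 ?sqr_ge0 ?ltW.
Qed.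

End sections.

(** * Strict positive definiteness of the kernel *)

Theorem theorem3 (R : realType) (d : nat) (hd : (2 < d)%N)
  (K : 'rV[R]_d -> 'rV[R]_d -> R[i])
  (c : int -> (d - 2).-tuple int -> (d - 2).-tuple int -> R[i])
  (hK_herm : hermitian_kernel (@unit_sphere R d) K)
  (hK_axial : axially_symmetric K)
  (hK_sum : forall t u : (d - 1).-tuple R, polar_range t -> polar_range u ->
     has_sum (@expansion_index d)
       (fun p => c p.1.1 p.1.2 p.2 * Ysph p.1.1 p.1.2 t * (Ysph p.1.1 p.2 u)^*)
       (K (polar t) (polar u)))
  (hc_sum : (\esum_(p in @expansion_index d)
       (Normc.normc (c p.1.1 p.1.2 p.2)
        * (Num.sqrt (harmonic_dim R d (degree p.1.2)
                     * harmonic_dim R d (degree p.2))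
           / sphere_area R d))%:E < +oo)%E)
  (e : int -> nat -> (d - 2).-tuple int)
  (he_bij : forall l1 : int, set_bij [set: nat] (@Lambda d l1) (e l1))
  (he_mono : forall (l1 : int) (a' a : nat), (a' < a)%N ->
     (degree (e l1 a') <= degree (e l1 a))%N)
  (hA_posdef : forall (l1 : int) (n : nat), (1 <= n)%N ->
     posdefmx (\matrix_(a < n, b < n) tilde_a c l1 (e l1) a b))
  (hA_dom : forall l1 : int, exists s : R, 0 < s < 1 /\
     forall a : nat,
       (\esum_(b in [set b | b != a])
          (Normc.normc (tilde_a c l1 (e l1) a b))%:E
        < (s * Normc.normc (tilde_a c l1 (e l1) a a))%:E)%E) :
  strictly_posdef_kernel (@unit_sphere R d) K.
Proof.
move=> n x xinj xS v v0.
have /choice[t ht] : forall i, exists t : (d - 1).-tuple R,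
    polar_range t /\ polar t = x i.
  by move=> i; have [t tr tx] := polar_surjective hd (xS i); exists t.
have ht1 i : polar_range (t i) by have [] := ht i.
have ht2 i : polar (t i) = x i by have [] := ht i.
set Q := \sum_i _.
have QE : Q = \sum_(i < n) \sum_(j < n) (v i 0)^* * K (x i) (x j) * v j 0.
  by apply: eq_bigr => i _; apply: eq_bigr => j _; rewrite mxE.
have KE i j : (K (x i) (x j) = (K (x j) (x i))^*)%R by exact: hK_herm.
(* The expansion controls only the real part of the form; Hermitian symmetry of K disposes of the
   imaginary part. *)
have Qreal : (Q^* = Q)%R.
  rewrite QE rmorph_sum/= [RHS]exchange_big/=; apply: eq_bigr => j _.
  rewrite rmorph_sum/=; apply: eq_bigr => i _.
  by rewrite !rmorphM/= conjCK [in RHS]KE; ring.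
pose eta l1 l : R[i] := (\sum_i (v i 0)^* * Ysph l1 l (t i))%R.
have eta_neq0 : exists l1 l, Lambda l1 l /\ eta l1 l != 0.
  apply: contrapT => h.
  have w0 : forall i, ((v i 0)^*)%R = 0.
    apply: (harmonics_separate hd ht1).
      by move=> i j /=; rewrite !ht2; exact: xinj.
    move=> l1 l hl; apply/eqP/negPn/negP => hn; apply: h.
    by exists l1, l.
  move/eqP: v0; apply; apply/colP => i; rewrite mxE.
  by apply/eqP; rewrite -conjC_eq0 w0.
have hQ : has_sum (expansion_index (d := d))
    (fun p => c p.1.1 p.1.2 p.2 * eta p.1.1 p.1.2 * (eta p.1.1 p.2)^*) Q.
  (* Weighting the expansion of K(x_i, x_j) by conj(v_i) v_j and summing over i and j factors each
     term through eta and its conjugate. *)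
  have hij i j := has_sumZ ((v i 0)^* * v j 0) (hK_sum _ _ (ht1 i) (ht1 j)).
  have := has_sum_sum (index_enum 'I_n)
    (fun i => has_sum_sum (index_enum 'I_n) (hij i)).
  congr (has_sum _ _ _).
    apply/funext => p; rewrite /eta [in RHS]rmorph_sum/=.
    rewrite [X in _ = X * _]mulr_sumr [RHS]mulr_suml; apply: eq_bigr => i _.
    rewrite [RHS]mulr_sumr; apply: eq_bigr => j _.
    by rewrite [in RHS]rmorphM/= [in RHS]conjCK; ring.
  rewrite QE; apply: eq_bigr => i _; apply: eq_bigr => j _.
  by rewrite !ht2; ring.
have := expansion_Re_gt0 hd he_bij hA_posdef hA_dom eta_neq0 hQ.
move: Qreal; rewrite ltcE; case: (Q) => a b /= [hb] ->.
by rewrite andbT; apply/eqP; lra.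
Qed.
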